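(* For each $r\in\mathfrak{P}$, every full minimal isometric immersion of the flat $3$-torus $\mathbb{T}^3_r$ into $\mathbb{S}^{23}$ is an embedding.
   Context: $\mathfrak{P}$ is the set of prime numbers congruent to $1$ modulo $4$. For $r\in\mathfrak{P}$, let $\Lambda_{3,r}^*\subset\mathbb{R}^3$ be the lattice generated by $$\eta_1=\Big(\tfrac{2}{\sqrt3},0,0\Big)^t,\quad \eta_2=\sqrt{\tfrac23}\Big(-\tfrac1{\sqrt2},\tfrac1r,0\Big)^t,\quad \eta_3=\sqrt{\tfrac23}\Big(-\tfrac1{\sqrt2},0,\tfrac1r\Big)^t,$$ and let $\Lambda_{3,r}=\{v\in\mathbb{R}^3:\langle v,\xi\rangle\in\mathbb{Z}\ \forall \xi\in\Lambda_{3,r}^*\}$ be its dual lattice. $\mathbb{T}^3_r=\mathbb{R}^3/\Lambda_{3,r}$ is equipped with the metric $\frac{4\pi^2}{3}(du_1^2+du_2^2+du_3^2)$. Here $\mathbb{S}^{23}\subset\mathbb{R}^{24}$ is the unit round sphere, and an immersion into it is full if its image is not contained in a proper linear subspace of $\mathbb{R}^{24}$. *)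

(* Defs.v *)
From HB Require Import structures.
From mathcomp Require Import all_boot all_order all_algebra.
From mathcomp Require Import all_classical all_reals all_analysis.
Import Order.TTheory GRing.Theory Num.Theory.
Import numFieldNormedType.Exports.

Set Implicit Arguments.
Unset Strict Implicit.
Unset Printing Implicit Defensive.

Local Open Scope classical_set_scope.
Local Open Scope ring_scope.
Local Open Scope quotient_scope.

Definition dot {R : realType} {n : nat} (u v : 'rV[R]_n) : R :=
  \sum_(i < n) u 0 i * v 0 i.

Definition lattice_span {R : realType} {n k : nat} (b : 'I_k -> 'rV[R]_n) :
  set 'rV[R]_n := [set v | exists c : 'I_k -> int, v = \sum_(i < k) b i *~ c i].

Definition dual_lattice {R : realType} {n : nat} (L : set 'rV[R]_n) :
  set 'rV[R]_n := [set v | forall xi, L xi -> dot v xi \is a Num.int].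

Section FlatTorus.
Context {R : realType} {n : nat} (L : set 'rV[R]_n.+1).

Definition torus_rel : rel 'rV[R]_n.+1 :=
  [rel x y | `[< dual_lattice L (x - y) >]].

Lemma torus_rel_refl : reflexive torus_rel.
Proof.
move=> x; apply/asboolP => xi _; rewrite /dot big1 ?rpred0// => i _.
by rewrite subrr mxE mul0r.
Qed.

Lemma torus_rel_sym : symmetric torus_rel.
Proof.
have sub x y : torus_rel x y -> torus_rel y x.
  move=> /asboolP xy; apply/asboolP => xi Lxi.
  rewrite (_ : dot _ _ = - dot (x - y) xi); first by rewrite rpredN xy.
  rewrite /dot -sumrN; apply: eq_bigr => i _.
  by rewrite -mulNr !mxE opprB.
by move=> x y; apply/idP/idP; exact: sub.
Qed.

Lemma torus_rel_trans : transitive torus_rel.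
Proof.
move=> y x z /asboolP xy /asboolP yz; apply/asboolP => xi Lxi.
rewrite (_ : dot _ _ = dot (x - y) xi + dot (y - z) xi).
  by rewrite rpredD ?xy ?yz.
rewrite /dot -big_split/=; apply: eq_bigr => i _.
by rewrite -mulrDl !mxE addrA subrK.
Qed.

Canonical torus_equiv :=
  EquivRel torus_rel torus_rel_refl torus_rel_sym torus_rel_trans.

(* The quotient is by the dual of L, not by L itself. *)
Definition flat_torus : Type := quotient_topology {eq_quot torus_equiv}.

(* The smooth structure of the torus is the one for which the projection is a
   local diffeomorphism, so a map is studied through its periodic lift. *)
Definition periodic_lift {T : Type} (f : flat_torus -> T) : 'rV[R]_n.+1 -> T :=
  fun x => f (\pi_flat_torus x).

End FlatTorus.

Section Immersions.
Context {R : realType} {n N : nat}.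
Implicit Types F : 'rV[R]_n.+1 -> 'rV[R]_N.+1.

Fixpoint Ck (k : nat) F : Prop :=
  if k is k'.+1 then
    (forall x, differentiable F x) /\ forall v, Ck k' (fun x => 'D_v F x)
  else continuous F.

Definition smooth F : Prop := forall k, Ck k F.

Definition partial (i : 'I_n.+1) F : 'rV[R]_n.+1 -> 'rV[R]_N.+1 :=
  fun x => 'D_(delta_mx 0 i) F x.

(* 'J F x has the partial derivatives of F at x as rows. *)
Definition induced_metric F (x : 'rV[R]_n.+1) : 'M[R]_n.+1 :=
  'J F x *m ('J F x)^T.

(* For F with values in the unit sphere: orthogonal projection onto the space
   normal, within the sphere, to the immersion at x, i.e. onto the orthogonal
   complement of the span of the position vector and the tangent vectors.
   It acts on row vectors by right multiplication. *)
Definition normal_proj F (x : 'rV[R]_n.+1) : 'M[R]_N.+1 :=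
  let A := col_mx (F x) ('J F x) in
  proj_mx (kermx A^T) <<A>>%MS.

Definition second_fundamental_form F (x : 'rV[R]_n.+1) (i j : 'I_n.+1) :
  'rV[R]_N.+1 := partial i (partial j F) x *m normal_proj F x.

Definition mean_curvature F (x : 'rV[R]_n.+1) : 'rV[R]_N.+1 :=
  n.+1%:R^-1 *: \sum_(i < n.+1) \sum_(j < n.+1)
    invmx (induced_metric F x) i j *: second_fundamental_form F x i j.

End Immersions.

Section TorusMaps.
Context {R : realType} {n N : nat} {L : set 'rV[R]_n.+1}.
Implicit Types f : flat_torus L -> 'rV[R]_N.+1.

Definition in_unit_sphere f : Prop := forall t, dot (f t) (f t) = 1.

Definition immersion f : Prop :=
  smooth (periodic_lift f) /\ forall x, row_free ('J (periodic_lift f) x).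

(* isometric for the metric c (du_1^2 + ... + du_n^2) on the torus *)
Definition isometric (c : R) f : Prop :=
  forall x, induced_metric (periodic_lift f) x = c%:M.

(* minimal as a map into the unit sphere *)
Definition minimal f : Prop := forall x, mean_curvature (periodic_lift f) x = 0.

Definition full f : Prop :=
  forall V : {vspace 'rV[R]_N.+1}, (forall t, f t \in V) -> V = fullv.

Definition homeo_onto_image f : Prop :=
  [/\ continuous f, injective f &
      forall U : set (flat_torus L), open U ->
        exists2 V : set 'rV[R]_N.+1, open V & f @` U = V `&` range f].

Definition embedding f : Prop := immersion f /\ homeo_onto_image f.

End TorusMaps.

Definition row3 {R : realType} (a b c : R) : 'rV[R]_3 :=
  \row_(j < 3) [:: a; b; c]`_j.

Definition eta {R : realType} (r : nat) (i : 'I_3) : 'rV[R]_3 :=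
  [:: row3 (2 / Num.sqrt 3) 0 0;
      Num.sqrt (2 / 3) *: row3 (- (Num.sqrt 2)^-1) r%:R^-1 0;
      Num.sqrt (2 / 3) *: row3 (- (Num.sqrt 2)^-1) 0 r%:R^-1]`_i.

Definition Lambda3_dual {R : realType} (r : nat) : set 'rV[R]_3 :=
  lattice_span (eta r).

Definition torus3 (R : realType) (r : nat) : Type :=
  flat_torus (@Lambda3_dual R r).

(* Main.v *)
(* Takahashi's theorem: minimality makes the lift F of f an eigenmap of the flat
   Laplacian, here with eigenvalue -4 pi^2, so that F is a combination of the
   waves cos(2 pi <xi, x> + a) with xi a unit vector of the lattice generated by
   the eta_i. In the coordinates (m, x, y) of that lattice, unit vectors are the
   solutions of m^2 = 1 and x^2 + y^2 = r^2, and r being prime there are at most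
   24 of them. A full map into R^24 needs 24 of the functions cos and sin, so
   all 24 vectors occur and the coefficient matrix is invertible: F(x) = F(y)
   then forces <xi, x - y> to be an integer for all of them. As they generate
   the lattice, f is injective, hence an embedding of the compact torus.

   Fourier analysis is done with an invariant mean (an ultralimit of grid
   averages) instead of an integral; completeness of the waves follows by
   testing against powers of a trigonometric polynomial that peaks exactly on
   the period lattice. *)
Require Import Defs.
From mathcomp Require Import all_boot all_order all_algebra.
From mathcomp Require Import all_classical all_reals all_analysis.
From mathcomp Require Import ring lra zify.
Import Order.TTheory GRing.Theory Num.Theory.
Import numFieldNormedType.Exports.

Set Implicit Arguments.
Unset Strict Implicit.
Unset Printing Implicit Defensive.

Local Open Scope classical_set_scope.
Local Open Scope ring_scope.

(** * Grid averages and the invariant mean *)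

(** A mean fit for Fourier coefficients must vanish on derivatives. Grid averages provide this: a
    shift by one grid step only permutes the grid, so a difference quotient with that step averages
    to exactly 0.

    The metric constant is tuned to unit frequencies: three directions times 4 pi^2 / 3 make (2
    pi)^2. In the coordinates of the overview a unit vector satisfies m^2 r^2 + 2 (x^2 + y^2) = 3
    r^2, and r being odd excludes m = 0. As xi and -xi carry the same waves, only the vectors with m
    = 1 are kept, each with a cosine and a sine. There are at most 12 = 4 + 8 of them: the 4 points
    of the circle on the axes, and the signs and swaps of one further point. Fullness forces that
    point to exist. It is also what makes the unit vectors generate the lattice, since the axis
    points alone control the x and y directions only up to multiples of r. *)

Section GridAverage.
Context {R : realType} {V : normedModType R}.
Implicit Types (h g : V -> R) (p v x : V) (ps : seq V) (N : nat).

Definition unif_bounded h := exists B : R, forall x, `|h x| <= B.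

Definition avg N p h x : R := N%:R^-1 * \sum_(k < N) h (x + (k%:R / N%:R) *: p).

(** Iterating over the periods averages over a grid with spacing [1 / N] along each of them; as a
    fold, every property reduces to a single direction. *)
Definition gridavg N ps h : V -> R := foldr (avg N) h ps.

Lemma avgD N p h g : avg N p (h \+ g) = avg N p h \+ avg N p g.
Proof. by apply/funext => x /=; rewrite /avg big_split/= mulrDr. Qed.

Lemma avgZ N p (a : R) h : avg N p (fun x => a * h x) = fun x => a * avg N p h x.
Proof. by apply/funext => x /=; rewrite /avg -mulr_sumr mulrCA. Qed.

Lemma avg_cst N p (a : R) : avg N.+1 p (fun=> a) = fun=> a.
Proof.
apply/funext => x; rewrite /avg sumr_const card_ord -[a *+ _]mulr_natr mulrCA.
by rewrite mulVf ?mulr1// pnatr_eq0.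
Qed.

Lemma avg_shift N p v h : avg N p (fun x => h (x + v)) = fun x => avg N p h (x + v).
Proof. by apply/funext => x; rewrite /avg; under eq_bigr do rewrite addrAC. Qed.

Lemma le_avg N p h g : (forall x, h x <= g x) -> forall x, avg N p h x <= avg N p g x.
Proof.
by move=> hg x; rewrite /avg ler_wpM2l ?invr_ge0 ?ler0n//; apply: ler_sum.
Qed.

Lemma gridavgD N ps h g : gridavg N ps (h \+ g) = gridavg N ps h \+ gridavg N ps g.
Proof. by elim: ps => //= p ps ->; rewrite avgD. Qed.

Lemma gridavgZ N ps (a : R) h :
  gridavg N ps (fun x => a * h x) = fun x => a * gridavg N ps h x.
Proof. by elim: ps => //= p ps ->; rewrite avgZ. Qed.

Lemma gridavg_cst N ps (a : R) : gridavg N.+1 ps (fun=> a) = fun=> a.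
Proof. by elim: ps => //= p ps ->; rewrite avg_cst. Qed.

Lemma gridavg_shift N ps v h :
  gridavg N ps (fun x => h (x + v)) = fun x => gridavg N ps h (x + v).
Proof. by elim: ps => //= p ps ->; rewrite avg_shift. Qed.

Lemma le_gridavg N ps h g : (forall x, h x <= g x) ->
  forall x, gridavg N ps h x <= gridavg N ps g x.
Proof. by move=> hg; elim: ps => //= p ps ih x; exact: le_avg. Qed.

Lemma gridavg_bounded N ps h (B : R) : (forall x, `|h x| <= B) ->
  forall x, `|gridavg N.+1 ps h x| <= B.
Proof.
move=> hB x; rewrite ler_norml; apply/andP; split.
  rewrite -[leLHS](congr1 (fun f => f x) (gridavg_cst N ps (- B))).
  by apply: le_gridavg => y; have := hB y; rewrite ler_norml => /andP[].
rewrite -[leRHS](congr1 (fun f => f x) (gridavg_cst N ps B)).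
by apply: le_gridavg => y; have := hB y; rewrite ler_norml => /andP[].
Qed.

(** The shift permutes the sample points cyclically: the last one lands on [x + p], which
    periodicity identifies with [x]. *)
Lemma avg_step N p h : periodic h p ->
  avg N.+1 p (fun x => h (x + N.+1%:R^-1 *: p)) = avg N.+1 p h.
Proof.
move=> hp; apply/funext => x; rewrite /avg; congr (_ * _).
have step k : x + (k%:R / N.+1%:R) *: p + N.+1%:R^-1 *: p =
    x + (k.+1%:R / N.+1%:R) *: p.
  by rewrite -addrA -scalerDl -[k.+1%:R]natr1 mulrDl mul1r.
under eq_bigr do rewrite step.
rewrite big_ord_recr big_ord_recl /= mul0r scale0r addr0 addrC.
rewrite divff ?pnatr_eq0// scale1r hp.
by congr (_ + _); apply: eq_bigr.
Qed.

Lemma gridavg_step N ps p h : p \in ps -> periodic h p ->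
  gridavg N.+1 ps (fun x => h (x + N.+1%:R^-1 *: p)) = gridavg N.+1 ps h.
Proof.
move=> + hp; elim: ps => //= q ps ih; rewrite inE => /predU1P[<-|/ih ->//].
rewrite gridavg_shift avg_step// => x.
by rewrite -[LHS](congr1 (fun f => f x) (gridavg_shift N.+1 ps p h)) (funext hp).
Qed.

(** The sample points with [k <= N %/ l] stay within [|p| / l] of [x], and they are at least the
    fraction [1 / l] of all, whatever [N] is. *)
Lemma avg_near_ge N p h (e d : R) (l : nat) : (0 < l)%N -> 0 <= d ->
    `|p| / l%:R < e -> (forall x, 0 <= h x) ->
    (forall x, `|x| < e *+ 2 -> d <= h x) ->
  forall x, `|x| < e -> d / l%:R <= avg N.+1 p h x.
Proof.
move=> l0 d0 ple h0 hd x xe; have lR : 0 < l%:R :> R by rewrite ltr0n.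
rewrite /avg [leRHS]mulrC ler_pdivlMr ?ltr0n//.
pose m := (N %/ l).+1; have mN : (m <= N.+1)%N by rewrite ltnS leq_div.
rewrite (bigID (fun k : 'I_N.+1 => (k < m)%N))/= -[leLHS]addr0.
apply: lerD; last by apply: sumr_ge0.
apply: (@le_trans _ _ (\sum_(k < N.+1 | (k < m)%N) d)).
  rewrite -(big_ord_widen _ (fun=> d) mN) sumr_const card_ord -[leRHS]mulr_natr.
  rewrite -mulrA ler_wpM2l// mulrC ler_pdivrMr// -natrM ler_nat.
  by rewrite /m ltn_ceil.
apply: ler_sum => k km; apply: hd; rewrite mulr2n.
apply: le_lt_trans (ler_normD _ _) _; apply: ltrD => //.
apply: le_lt_trans ple; rewrite normrZ mulrC ler_wpM2l// ger0_norm ?divr_ge0//.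
rewrite ler_pdivrMr ?ltr0n// mulrC ler_pdivlMr// -natrM ler_nat.
rewrite ltnS in km; have := leq_divM N l; nia.
Qed.

(** Uniformity in [N] lets the bound survive the limit. Each further period costs half the radius
    and a factor [l] in the value. *)
Lemma gridavg_near_ge ps h (e d : R) : 0 < e -> 0 < d -> (forall x, 0 <= h x) ->
    (forall x, `|x| < e -> d <= h x) ->
  exists e' d' : R, [/\ 0 < e', 0 < d' &
    forall N x, `|x| < e' -> d' <= gridavg N.+1 ps h x].
Proof.
move=> e0 d0 h0 hd; elim: ps => [|p ps [e' [d' [e'0 d'0 ih]]]]/=.
  by exists e, d; split => // _; exact: hd.
pose l := (Num.truncn (`|p| / (e' / 2))).+1.
have lR : 0 < l%:R :> R by rewrite ltr0n.
exists (e' / 2), (d' / l%:R); split; rewrite ?divr_gt0// => N x xe.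
apply: (@avg_near_ge _ _ _ (e' / 2)) => //; first exact: ltW.
- by rewrite ltr_pdivrMr// mulrC -ltr_pdivrMr ?divr_gt0// truncnS_gt.
- move=> y; rewrite -[leLHS](congr1 (fun f => f y) (gridavg_cst N ps 0)).
  exact: le_gridavg.
- by move=> y; rewrite -[_ *+ _]mulr_natr divfK ?pnatr_eq0//; exact: ih.
Qed.

End GridAverage.

Lemma ultra_fmap {T U : Type} (f : T -> U) (F : set_system T) :
  UltraFilter F -> UltraFilter (f @ F).
Proof.
move=> FU; have FP : ProperFilter F := @ultra_proper _ _ FU.
have fFP : ProperFilter (f @ F) := fmap_proper_filter f FP.
apply: (@Build_UltraFilter _ _ fFP) => G GF sFG; apply/seteqP; split=> // A GA.
have [//|FA] := in_ultra_setVsetC (f @^-1` A) FU.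
have GCA : G (~` A) by exact: sFG.
by case: (filter_ex (filterI GA GCA)) => x [].
Qed.

(* Integration over the torus is replaced by the limit of averages over finer
   and finer grids along an ultrafilter: the limit exists for all bounded
   functions, and only its linearity, its positivity and its vanishing on
   derivatives matter. *)
Definition grid_ultrafilter : set_system nat :=
  projT1 (cid (ultraFilterLemma eventually_filter)).

Lemma grid_ultrafilter_ultra : UltraFilter grid_ultrafilter.
Proof. by rewrite /grid_ultrafilter; case: cid => G []. Qed.

#[local] Instance grid_ultrafilter_proper : ProperFilter grid_ultrafilter.
Proof. exact: (@ultra_proper _ _ grid_ultrafilter_ultra). Qed.

Lemma grid_ultrafilter_eventually : \oo `<=` grid_ultrafilter.
Proof. by rewrite /grid_ultrafilter; case: cid => G []. Qed.

Section Mean.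
Context {R : realType} {V : normedModType R} (ps : seq V).
Implicit Types (h g : V -> R) (p v x : V).
Local Notation U := grid_ultrafilter.

Definition mean h : R := lim (gridavg N.+1 ps h 0 @[N --> U]).

(** The averages stay in the compact interval [[-B, B]], where every ultrafilter converges. *)
Lemma mean_cvg h : unif_bounded h -> gridavg N.+1 ps h 0 @[N --> U] --> mean h.
Proof.
move=> [B hB]; have cB := @segment_compact R (- B) B.
rewrite compact_ultra in cB.
have [|l [_ /= Ul]] :=
  cB _ (ultra_fmap (fun N => gridavg N.+1 ps h 0) grid_ultrafilter_ultra).
  apply: nearW => N /=; rewrite in_itv/= -ler_norml; exact: gridavg_bounded.
by apply: cvgP; exact: Ul.
Qed.

Lemma mean_cvg_eq h (l : R) :
  gridavg N.+1 ps h 0 @[N --> U] --> l -> mean h = l.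
Proof. by move=> hl; exact: (cvg_lim (@Rhausdorff R) hl). Qed.

Lemma meanD h g : unif_bounded h -> unif_bounded g ->
  mean (h \+ g) = mean h + mean g.
Proof.
move=> bh bg; apply: mean_cvg_eq; rewrite (_ : (fun N => _) =
  (fun N => gridavg N.+1 ps h 0) \+ (fun N => gridavg N.+1 ps g 0)).
  by apply: cvgD; exact: mean_cvg.
by apply/funext => N; rewrite gridavgD.
Qed.

Lemma meanZ (a : R) h : unif_bounded h -> mean (fun x => a * h x) = a * mean h.
Proof.
move=> bh; apply: mean_cvg_eq; under eq_fun do rewrite gridavgZ.
by apply: cvgMl_tmp; exact: mean_cvg.
Qed.

Lemma mean_ge0 h : unif_bounded h -> (forall x, 0 <= h x) -> 0 <= mean h.
Proof.
move=> bh h0; apply: (ler_cvg_to (cvg_cst 0) (mean_cvg bh)).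
apply: nearW => N; rewrite -[leLHS](congr1 (fun f => f 0) (gridavg_cst N ps 0)).
exact: le_gridavg.
Qed.

Lemma mean_cst (a : R) : mean (fun=> a) = a.
Proof. by apply: mean_cvg_eq; under eq_fun do rewrite gridavg_cst; exact: cvg_cst. Qed.

Lemma is_derive_line h x p (s d : R) : is_derive (x + s *: p) p h d <->
  is_derive s 1 (fun t => h (x + t *: p)) d.
Proof.
have E : (fun t : R => t^-1 *: (h (t *: p + (x + s *: p)) - h (x + s *: p))) =
    (fun t : R => t^-1 *: (h (x + (t *: 1 + s) *: p) - h (x + s *: p))).
  by apply/funext => t; rewrite addrCA scalerDl /GRing.scale/= mulr1.
split=> -[dv <-]; split.
- by move: dv; rewrite /derivable E.
- by rewrite /derive E.
- by move: dv; rewrite /derivable -E.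
- by rewrite /derive -E.
Qed.

(** The mean value theorem, applied to [h] and then to [h1], writes the remainder as [t * c] times a
    value of [h2], with [c <= t]. *)
Lemma taylor1_le h h1 h2 p (B t : R) x : 0 <= t ->
  (forall x, is_derive x p h (h1 x)) -> (forall x, is_derive x p h1 (h2 x)) ->
  (forall x, `|h2 x| <= B) ->
  `|h (x + t *: p) - h x - t * h1 x| <= B * t ^+ 2.
Proof.
move=> t0 dh dh1 hB.
have du (s : R) : is_derive s 1 (fun t => h (x + t *: p)) (h1 (x + s *: p)).
  exact/is_derive_line.
have du1 (s : R) : is_derive s 1 (fun t => h1 (x + t *: p)) (h2 (x + s *: p)).
  exact/is_derive_line.
have cu (f df : R -> R) (b : R) : (forall s : R, is_derive s 1 f (df s)) ->
    {within `[0, b], continuous f}.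
  move=> df'; apply: continuous_subspaceT => s; apply: differentiable_continuous.
  by apply/derivable1_diffP; have [] := df' s.
have [c /[!in_itv]/= /andP[c0 ct] Ec] := MVT_segment t0 (fun s _ => du s) (cu _ _ _ du).
have [c' _ Ec'] := MVT_segment c0 (fun s _ => du1 s) (cu _ _ _ du1).
move: Ec Ec'; rewrite !scale0r !addr0 !subr0 => -> Ec'.
rewrite mulrC -mulrBr Ec' !normrM (ger0_norm t0) (ger0_norm c0).
have B0 : 0 <= B := le_trans (normr_ge0 _) (hB 0).
rewrite expr2 [leRHS]mulrCA ler_wpM2l//.
by apply: le_trans (ler_wpM2l B0 ct); rewrite ler_wpM2r.
Qed.

(** The difference quotient of step [1 / N.+1] has grid average 0 by [gridavg_step], and by Taylor's
    formula it differs from [h1] by at most [B / N.+1]. *)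
Lemma mean_derive0 p h h1 h2 : p \in ps -> periodic h p ->
  (forall x, is_derive x p h (h1 x)) -> (forall x, is_derive x p h1 (h2 x)) ->
  unif_bounded h2 -> mean h1 = 0.
Proof.
move=> pps hp dh dh1 [B hB]; apply: mean_cvg_eq.
have B0 : 0 <= B := le_trans (normr_ge0 _) (hB 0).
have bound N : `|gridavg N.+1 ps h1 0| <= B * N.+1%:R^-1.
  pose q x := h (x + N.+1%:R^-1 *: p) - h x.
  have q0 : gridavg N.+1 ps (fun x => N.+1%:R * q x) 0 = 0.
    rewrite gridavgZ (_ : q = (fun x => h (x + N.+1%:R^-1 *: p)) \+
      (fun x => -1 * h x)); last by apply/funext => x /=; rewrite mulN1r.
    by rewrite gridavgD gridavgZ gridavg_step//= mulN1r subrr mulr0.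
  have : `|gridavg N.+1 ps ((fun x => N.+1%:R * q x) \+
      (fun x => -1 * (N.+1%:R * q x - h1 x))) 0| <= B * N.+1%:R^-1.
    rewrite gridavgD/= q0 add0r; apply: gridavg_bounded => x.
    rewrite normrM normrN1 mul1r.
    rewrite (_ : _ - _ = N.+1%:R * (q x - N.+1%:R^-1 * h1 x)); last first.
      by rewrite [RHS]mulrBr mulrA divff ?mul1r// pnatr_eq0.
    rewrite normrM normr_nat mulrC -ler_pdivlMr ?ltr0n// -mulrA -expr2.
    by apply: taylor1_le.
  congr (`|gridavg _ _ _ _| <= _); apply/funext => x /=; rewrite mulN1r opprB.
  by rewrite addrCA subrr addr0.
apply/cvgr0Pnorm_lt => e e0.
have : \forall N \near \oo, B * (N.+1%:R^-1 : R) < e.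
  have : B * (N.+1%:R^-1 : R) @[N --> \oo] --> 0.
    rewrite -[X in _ --> X](mulr0 B); apply: cvgMl_tmp; exact: cvg_harmonic.
  by move=> /cvgr_lt; apply.
by move=> /grid_ultrafilter_eventually; apply: filterS => N; apply: le_lt_trans.
Qed.

End Mean.

(** * Waves *)

Section Dot.
Context {R : realType} {n : nat}.
Implicit Types (u v w : 'rV[R]_n) (a : R).

Lemma dotE u v : dot u v = (u *m v^T) 0 0.
Proof. by rewrite mxE; apply: eq_bigr => i _; rewrite mxE. Qed.

Lemma dotC u v : dot u v = dot v u.
Proof. by apply: eq_bigr => i _; rewrite mulrC. Qed.

Lemma dotDl u v w : dot (u + v) w = dot u w + dot v w.
Proof. by rewrite !dotE mulmxDl mxE. Qed.

Lemma dotZl a u v : dot (a *: u) v = a * dot u v.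
Proof. by rewrite !dotE -scalemxAl mxE. Qed.

Lemma dotDr u v w : dot u (v + w) = dot u v + dot u w.
Proof. by rewrite dotC dotDl !(dotC u). Qed.

Lemma dotZr a u v : dot u (a *: v) = a * dot u v.
Proof. by rewrite dotC dotZl dotC. Qed.

Lemma dotNl u v : dot (- u) v = - dot u v.
Proof. by rewrite -scaleN1r dotZl mulN1r. Qed.

Lemma dotNr u v : dot u (- v) = - dot u v.
Proof. by rewrite dotC dotNl dotC. Qed.

Lemma dotBl u v w : dot (u - v) w = dot u w - dot v w.
Proof. by rewrite dotDl dotNl. Qed.

Lemma dotBr u v w : dot u (v - w) = dot u v - dot u w.
Proof. by rewrite dotDr dotNr. Qed.

Lemma dotMz u v (m : int) : dot (u *~ m) v = m%:~R * dot u v.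
Proof. by rewrite -scaler_int dotZl. Qed.

Lemma dot0l u : dot 0 u = 0.
Proof. by rewrite dotE mul0mx mxE. Qed.

Lemma dot0r u : dot u 0 = 0.
Proof. by rewrite dotC dot0l. Qed.

Lemma dot_suml (I : Type) (s : seq I) (P : pred I) (F : I -> 'rV[R]_n) u :
  dot (\sum_(i <- s | P i) F i) u = \sum_(i <- s | P i) dot (F i) u.
Proof. by apply: (big_morph (dot^~ u)) => [v w|]; rewrite ?dotDl ?dot0l. Qed.

Lemma dot_sumr (I : Type) (s : seq I) (P : pred I) (F : I -> 'rV[R]_n) u :
  dot u (\sum_(i <- s | P i) F i) = \sum_(i <- s | P i) dot u (F i).
Proof. by rewrite dotC dot_suml; apply: eq_bigr => i _; rewrite dotC. Qed.

Lemma dot_delta u (i : 'I_n) : dot u (delta_mx 0 i) = u 0 i.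
Proof.
rewrite /dot (bigD1 i)//= big1 => [|j ji]; first by rewrite mxE !eqxx mulr1 addr0.
by rewrite mxE (negbTE ji) andbF mulr0.
Qed.

Lemma dot_eq0 u : (dot u u == 0) = (u == 0).
Proof.
apply/eqP/eqP => [|->]; last by rewrite dot0l.
move/eqP; rewrite psumr_eq0 => [/allP h|i _]; last by rewrite -expr2 sqr_ge0.
apply/rowP => i; rewrite mxE; apply/eqP.
by have := h i (mem_index_enum i); rewrite /= mulf_eq0 orbb.
Qed.

End Dot.

Section Continuity.
Context {R : realType} {T : topologicalType}.

Lemma sum_continuous (W : normedModType R) (I : Type) (s : seq I) (P : pred I)
    (F : I -> T -> W) :
  (forall i, P i -> continuous (F i)) ->
  continuous (fun x => \sum_(i <- s | P i) F i x).
Proof.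
move=> cF; rewrite (_ : (fun x => _) = \sum_(i <- s | P i) F i); last first.
  by apply/funext => x; rewrite fct_sumE.
apply: (big_ind (fun f : T -> W => continuous f)) => // [x|f g cf cg x].
  exact: cvg_cst.
by apply: continuousD; [exact: cf|exact: cg].
Qed.

End Continuity.

Section Trigonometry.
Context {R : realType}.
Implicit Types (x y : R) (m : int).

Lemma periodicz (U V : zmodType) (h : U -> V) (t : U) :
  periodic h t -> forall m (x : U), h (x + t *~ m) = h x.
Proof.
move=> ht [] k x; first exact: (periodicn ht).
by rewrite NegzE mulrNz -[LHS](periodicn ht k.+1) -pmulrn subrK.
Qed.

Lemma cos_int x y : x \is a Num.int -> cos (2 * pi * x + y) = cos y.
Proof.
move=> /intrP[m ->]; rewrite addrC mulrzr mulr_natl.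
exact: (periodicz (@cosD2pi R)).
Qed.

(** For the fractional part [t] of [x], [cos (2 * pi * t)] is 1 minus twice the square of
    [sin (pi * t)], and this sine is positive for [0 < t < 1]. *)
Lemma cos_eq1 x : cos (2 * pi * x) = 1 -> x \is a Num.int.
Proof.
move=> cx; have fx := floor_itv x; pose t := x - (Num.floor x)%:~R.
have ct : cos (2 * pi * t) = 1.
  rewrite /t mulrBr -mulrN addrC cos_int// rpredN; exact: intr_int.
have /andP[t0 t1] : 0 <= t < 1.
  by move: fx; rewrite intrD /t => /andP[? ?]; apply/andP; split; lra.
suff t00 : t = 0.
  by rewrite (_ : x = (Num.floor x)%:~R) ?intr_int//; apply/subr0_eq.
apply/eqP; rewrite eq_le t0 andbT leNgt; apply/negP => tpos.
have s0 : 0 < sin (pi * t).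
  by apply: sin_gt0_pi; rewrite mulr_gt0 ?pi_gt0//= gtr_pMr ?pi_gt0.
move: ct; rewrite -mulrA mulr_natl cos_mulr2n => h.
have := cos2Dsin2 (pi * t); have : 0 < sin (pi * t) ^+ 2 by rewrite exprn_gt0.
lra.
Qed.

Lemma cosM x y : cos x * cos y = 2^-1 * (cos (x + y) + cos (x - y)).
Proof. by rewrite cosD cosB; field. Qed.

End Trigonometry.

Section Wave.
Context {R : realType} {n : nat}.
Implicit Types (xi eta x v : 'rV[R]_n.+1) (a : R).

(** The free phase replaces complex exponentials: a derivative is again a multiple of a wave, with
    [pi / 2] added to the phase, and products split into two waves. *)
Definition wave xi a x : R := cos (2 * pi * dot xi x + a).

Lemma wave_continuous xi a : continuous (wave xi a).
Proof.
move=> x; apply: continuous_comp; last exact: continuous_cos.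
apply: continuousD; last exact: cst_continuous.
apply: continuousM; first exact: cst_continuous.
rewrite /dot; apply: sum_continuous => i _ y.
apply: continuousM; first exact: cst_continuous.
exact: coord_continuous.
Qed.

Lemma is_derive_wave xi a x v :
  is_derive x v (wave xi a) (2 * pi * dot xi v * wave xi (a + pi / 2) x).
Proof.
rewrite -[x]addr0 -(scale0r v); apply/is_derive_line.
rewrite (_ : (fun t => _) = cos \o
  (fun t => (2 * pi * dot xi v) * t + (2 * pi * dot xi x + a))); last first.
  by apply/funext => t /=; rewrite /wave dotDr dotZr; congr cos; ring.
apply: is_derive_eq.
rewrite mulr0 add0r scale0r addr0 /wave addrA cosDpihalf.
have alg (k : R) : k%:A = k :> R by exact: mulr1.
by rewrite alg addr0; ring.
Qed.

Lemma waveM xi eta a c : wave xi a \* wave eta c =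
  (fun x => 2^-1 * wave (xi + eta) (a + c) x) \+
  (fun x => 2^-1 * wave (xi - eta) (a - c) x).
Proof.
apply/funext => x /=; rewrite /wave cosM dotDl dotBl -mulrDr.
by congr (_ * (cos _ + cos _)); ring.
Qed.

Lemma waveNl xi a : wave (- xi) a = wave xi (- a).
Proof.
by apply/funext => x; rewrite /wave dotNl mulrN -cosN opprD opprK.
Qed.

Lemma wave0 : wave 0 0 = fun=> 1.
Proof. by apply/funext => x; rewrite /wave dot0l mulr0 addr0 cos0. Qed.

Lemma wave_shift xi a x v : wave xi a (x + v) = wave xi (a + 2 * pi * dot xi v) x.
Proof. by rewrite /wave dotDr; congr cos; ring. Qed.

Lemma waveDpi xi a x : wave xi (a + pi) x = - wave xi a x.
Proof. by rewrite /wave addrA cosDpi. Qed.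

(* [wave xi (- (pi / 2))] is the sine wave. *)
Lemma wave_phase xi a x :
  wave xi a x = cos a * wave xi 0 x - sin a * wave xi (- (pi / 2)) x.
Proof. by rewrite /wave cosBpihalf addr0 cosD; ring. Qed.

End Wave.

(** * Fourier uniqueness on a torus *)

Section Lattice.
Context {R : realType} {n : nat} (b p : 'I_n.+1 -> 'rV[R]_n.+1).
Hypothesis bp : forall i j, dot (b i) (p j) = (i == j)%:R.
Implicit Types (xi eta x v : 'rV[R]_n.+1) (a : R) (h g phi : 'rV[R]_n.+1 -> R).

Local Notation L := (lattice_span b).
Local Notation M := (mean (codom p)).

(** Duality gives a one-sided inverse of the matrix of the [b i]; being square, it is inverted on
    the other side too. *)
Lemma dual_basis_expansion x : x = \sum_i dot (b i) x *: p i.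
Proof.
pose B := \matrix_i b i; pose P := \matrix_i p i.
have BP : B *m P^T = 1%:M.
  apply/matrixP => i j; rewrite [RHS]mxE -bp mxE.
  by apply: eq_bigr => k _; rewrite !mxE.
have := congr1 trmx (mulmx1C BP); rewrite trmx_mul trmxK trmx1 => BTP.
rewrite -[LHS]mulmx1 -BTP mulmxA mulmx_sum_row; apply: eq_bigr => i _.
congr (_ *: _); last by apply/rowP => j; rewrite !mxE.
by rewrite dotC dotE mxE; rewrite mxE; apply: eq_bigr => k _; rewrite !mxE.
Qed.

Lemma lattice_span_basis i : L (b i).
Proof.
exists (fun j => (j == i)%:Z); rewrite (bigD1 i)//= eqxx big1 ?addr0// => j ji.
by rewrite (negbTE ji).
Qed.

Lemma lattice_span0 : L 0.
Proof. by exists (fun=> 0); rewrite big1. Qed.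

Lemma lattice_spanB xi eta : L xi -> L eta -> L (xi - eta).
Proof.
move=> [c ->] [d ->]; exists (fun i => c i - d i).
by rewrite -sumrB; apply: eq_bigr => i _; rewrite mulrzBr.
Qed.

Lemma lattice_spanN xi : L xi -> L (- xi).
Proof. by rewrite -[- xi]sub0r; apply: lattice_spanB; exact: lattice_span0. Qed.

Lemma lattice_spanD xi eta : L xi -> L eta -> L (xi + eta).
Proof. by move=> Lxi Leta; rewrite -[eta]opprK; exact/lattice_spanB/lattice_spanN. Qed.

Lemma lattice_span_int xi i : L xi -> dot xi (p i) \is a Num.int.
Proof.
move=> [c ->]; rewrite dot_suml rpred_sum// => j _.
by rewrite -scaler_int dotZl bp rpredM ?intr_int ?natr_int.
Qed.

Lemma dual_lattice_basis i : dual_lattice L (p i).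
Proof. by move=> xi Lxi; rewrite dotC lattice_span_int. Qed.

Definition torus_fun h := continuous h /\ forall i, periodic h (p i).

Lemma torus_funD h g : torus_fun h -> torus_fun g -> torus_fun (h \+ g).
Proof.
move=> [ch ph] [cg pg]; split=> [x|i x /=]; last by rewrite ph pg.
by apply: continuousD; [exact: ch|exact: cg].
Qed.

Lemma torus_funM h g : torus_fun h -> torus_fun g -> torus_fun (h \* g).
Proof.
move=> [ch ph] [cg pg]; split=> [x|i x /=]; last by rewrite ph pg.
by apply: continuousM; [exact: ch|exact: cg].
Qed.

Lemma torus_fun_cst a : torus_fun (fun=> a).
Proof. by split => // x; exact: cst_continuous. Qed.

Lemma torus_funZ a h : torus_fun h -> torus_fun (fun x => a * h x).
Proof. exact: (torus_funM (torus_fun_cst a)). Qed.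

Lemma torus_fun_wave xi a : L xi -> torus_fun (wave xi a).
Proof.
move=> Lxi; split=> [|i x]; first exact: wave_continuous.
rewrite /wave dotDr mulrDr -addrA addrCA.
by rewrite [LHS]cos_int//; exact: lattice_span_int.
Qed.

(** A closed fundamental domain, for compactness, and centred, so that 0 is its only point of the
    period lattice. *)
Definition box : set 'rV[R]_n.+1 :=
  [set x | exists2 t : 'rV[R]_n.+1, (forall i, t 0 i \in `[-2^-1, 2^-1]) &
    x = \sum_i t 0 i *: p i].

Lemma box_compact : compact box.
Proof.
rewrite (_ : box = (fun t : 'rV[R]_n.+1 => \sum_i t 0 i *: p i) @`
    [set t : 'rV[R]_n.+1 |
      forall i, (`[-2^-1, 2^-1]%classic : set R) (t 0 i)]); last first.
  by apply/seteqP; split => x [t ht xt]; exists t.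
apply: continuous_compact.
  apply: continuous_subspaceT; apply: sum_continuous => i _ t.
  by apply: continuousZr_tmp; exact: coord_continuous.
apply: (@rV_compact R n.+1 (fun=> `[-2^-1, 2^-1]%classic)) => i.
exact: segment_compact.
Qed.

Lemma box_reduce x : exists2 v, lattice_span p v & box (x + v).
Proof.
pose m i := Num.floor (dot (b i) x + 2^-1).
exists (\sum_i p i *~ (- m i)); first by exists (fun i => - m i).
exists (\row_i (dot (b i) x - (m i)%:~R)) => [i|].
  have := floor_itv (dot (b i) x + 2^-1); rewrite -/(m i) mxE in_itv/= intrD.
  by move=> /andP[? ?]; apply/andP; split; lra.
rewrite [in LHS](dual_basis_expansion x) -big_split/=; apply: eq_bigr => i _.
by rewrite mxE scalerBl mulrNz scaler_int.
Qed.

Lemma torus_fun_lattice h v x : torus_fun h -> lattice_span p v -> h (x + v) = h x.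
Proof.
move=> [_ ph] [c ->]; elim/big_ind: _ x => [x|u w hu hw x|i _ x].
- by rewrite addr0.
- by rewrite addrA hw hu.
- exact: periodicz.
Qed.

Lemma torus_fun_bounded h : torus_fun h -> unif_bounded h.
Proof.
move=> th; have [ch _] := th.
have /compact_bounded[B [_ hB]] : compact (h @` box).
  by apply: continuous_compact box_compact; exact: continuous_subspaceT.
exists (B + 1) => x; have [v Lv xv] := box_reduce x.
rewrite -(torus_fun_lattice x th Lv); apply: (hB (B + 1)); first by rewrite ltrDl.
by exists (x + v).
Qed.

Lemma mean_ibp h h1 h2 xi a i : torus_fun h -> torus_fun h1 -> torus_fun h2 ->
  (forall x, is_derive x (p i) h (h1 x)) ->
  (forall x, is_derive x (p i) h1 (h2 x)) -> L xi ->
  M (h1 \* wave xi a) =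
    - (2 * pi * dot xi (p i)) * M (h \* wave xi (a + pi / 2)).
Proof.
move=> th th1 th2 dh dh1 Lxi; pose c := 2 * pi * dot xi (p i).
have tw a' := torus_fun_wave a' Lxi.
have dw a' x : is_derive x (p i) (wave xi a') (c * wave xi (a' + pi / 2) x).
  exact: is_derive_wave.
pose w1 := wave xi (a + pi / 2); pose w2 := wave xi (a + pi / 2 + pi / 2).
have : M ((h1 \* wave xi a) \+ (fun x => c * (h \* w1) x)) = 0.
  (* The last function is the second derivative of the product [h \* wave xi a], which
     [mean_derive0] requires to be bounded. *)
  apply: (@mean_derive0 _ _ _ (p i) (h \* wave xi a) _
    ((h2 \* wave xi a) \+ ((fun x => 2 * c * (h1 \* w1) x) \+
      (fun x => c ^+ 2 * (h \* w2) x)))).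
  - exact: codom_f.
  - by have [] := torus_funM th (tw a).
  - move=> x; apply: is_derive_eq.
    by rewrite /GRing.scale/= /w1; ring.
  - move=> x; apply: is_derive_eq.
    by rewrite /GRing.scale/= /w1 /w2; ring.
  - apply: torus_fun_bounded; apply: torus_funD.
      by apply: torus_funM => //; exact: tw.
    by apply: torus_funD; apply: torus_funZ; apply: torus_funM => //; exact: tw.
rewrite meanD ?meanZ; try by apply: torus_fun_bounded; do ?apply: torus_funZ;
  apply: torus_funM => //; exact: tw.
by move/eqP; rewrite addr_eq0 mulNr => /eqP.
Qed.

(** Up to the factor [2 * pi * dot xi (p i)], the wave is the derivative along [p i] of a wave with
    shifted phase. A nonzero mean would thus make every coordinate of [xi] vanish. *)
Lemma mean_wave0 xi a : L xi -> xi != 0 -> M (wave xi a) = 0.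
Proof.
move=> Lxi; have [c xiE] := Lxi; apply: contraNeq => Mw0.
have c0 i : c i = 0.
  have <- : M (fun x => 2 * pi * dot xi (p i) * wave xi a x) = 0 -> c i = 0.
    rewrite meanZ; last exact/torus_fun_bounded/torus_fun_wave.
    move=> /eqP; rewrite !mulf_eq0 (negbTE Mw0) orbF (gt_eqF (pi_gt0 _)) orbF.
    rewrite pnatr_eq0/= xiE dot_suml (bigD1 i)//= big1 => [|j ji].
      by rewrite -scaler_int dotZl bp eqxx mulr1 addr0 intr_eq0 => /eqP.
    by rewrite -scaler_int dotZl bp (negbTE ji) mulr0.
  by [].
  pose k := 2 * pi * dot xi (p i).
  apply: (@mean_derive0 _ _ _ (p i) (wave xi (a - pi / 2)) _
    (fun x => k * (k * wave xi (a + pi / 2) x))).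
  - exact: codom_f.
  - by have [] := torus_fun_wave (a - pi / 2) Lxi.
  - move=> x; rewrite -[in X in is_derive _ _ _ X](subrK (pi / 2) a).
    exact: is_derive_wave.
  - by move=> x; apply: is_deriveZ; exact: is_derive_wave.
  - by apply/torus_fun_bounded/torus_funZ/torus_funZ/torus_fun_wave.
by rewrite xiE big1// => i _; rewrite c0.
Qed.

Lemma mean_sum (I : Type) (s : seq I) (F : I -> 'rV[R]_n.+1 -> R) :
  (forall i, torus_fun (F i)) ->
  M (fun x => \sum_(i <- s) F i x) = \sum_(i <- s) M (F i).
Proof.
move=> tF; elim: s => [|i s ih].
  by rewrite big_nil; under eq_fun do rewrite big_nil; exact: mean_cst.
have ts : torus_fun (fun x => \sum_(i <- s) F i x).
  elim: s {ih} => [|j s ih]; under eq_fun do rewrite ?big_nil ?big_cons.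
    exact: torus_fun_cst.
  exact: (torus_funD (tF j) ih).
rewrite big_cons -ih -meanD; try exact: torus_fun_bounded.
by congr (M _); apply/funext => x; rewrite big_cons.
Qed.

Inductive trig_poly : ('rV[R]_n.+1 -> R) -> Prop :=
| trig_wave xi a : L xi -> trig_poly (wave xi a)
| trig_add h g : trig_poly h -> trig_poly g -> trig_poly (h \+ g)
| trig_scale a h : trig_poly h -> trig_poly (fun x => a * h x).

Lemma trig_poly_mul h g : trig_poly h -> trig_poly g -> trig_poly (h \* g).
Proof.
move=> th tg; elim: th => [xi a Lxi|h1 h2 _ ih1 _ ih2|a h1 _ ih].
- elim: tg => [eta c Leta|g1 g2 _ ih1 _ ih2|c g1 _ ih].
  + by rewrite waveM; apply: trig_add; apply: trig_scale; apply: trig_wave;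
      [exact: lattice_spanD|exact: lattice_spanB].
  + rewrite (_ : _ \* _ = (wave xi a \* g1) \+ (wave xi a \* g2)).
      exact: trig_add.
    by apply/funext => x /=; rewrite mulrDr.
  + rewrite (_ : _ \* _ = fun x => c * (wave xi a \* g1) x).
      exact: trig_scale.
    by apply/funext => x /=; rewrite mulrCA.
- rewrite (_ : _ \* _ = (h1 \* g) \+ (h2 \* g)); first exact: trig_add.
  by apply/funext => x /=; rewrite mulrDl.
- rewrite (_ : _ \* _ = fun x => a * (h1 \* g) x); first exact: trig_scale.
  by apply/funext => x /=; rewrite mulrA.
Qed.

Lemma torus_fun_trig h : trig_poly h -> torus_fun h.
Proof.
elim=> [xi a|h1 h2 _ th1 _ th2|a h1 _ th1]; first exact: torus_fun_wave.
- exact: torus_funD.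
- exact: torus_funZ.
Qed.

Lemma trig_poly_exp h m : trig_poly h -> trig_poly (fun x => h x ^+ m).
Proof.
move=> th; elim: m => [|m ih].
  rewrite (_ : (fun x => _) = wave 0 0); last by rewrite wave0; apply/funext.
  by apply: trig_wave; exact: lattice_span0.
rewrite (_ : (fun x => _) = h \* (fun x => h x ^+ m)); first exact: trig_poly_mul.
by apply/funext => x; rewrite exprS.
Qed.

(** The mean is based at 0, but its averages may be restarted from any grid point, and one of these
    lies within [s / N.+1] of [x0]. *)
Lemma mean_gt0_near h x0 (e d : R) : torus_fun h -> (forall x, 0 <= h x) ->
  0 < e -> 0 < d -> (forall x, `|x - x0| < e -> d <= h x) -> 0 < M h.
Proof.
move=> th h0 e0 d0 hd; have bh := torus_fun_bounded th.
have [||e' [d' [e'0 d'0 hN]]] :=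
  @gridavg_near_ge _ _ (codom p) (fun x => h (x + x0)) e d e0 d0.
- by move=> x.
- by move=> x xe; apply: hd; rewrite addrK.
apply: lt_le_trans d'0 _; apply: (ler_cvg_to (cvg_cst d') (@mean_cvg _ _ (codom p) _ bh)).
apply: grid_ultrafilter_eventually.
pose s := \sum_i `|p i|.
have : \forall N \near \oo, s * (N.+1%:R^-1 : R) < e'.
  have : s * (N.+1%:R^-1 : R) @[N --> \oo] --> 0.
    rewrite -[X in _ --> X](mulr0 s); apply: cvgMl_tmp; exact: cvg_harmonic.
  by move=> /cvgr_lt; apply.
apply: filterS => N sN; set G := gridavg _ _ h.
have GE x : gridavg N.+1 (codom p) (fun x => h (x + x0)) x = G (x + x0).
  exact: (congr1 (fun f => f x) (gridavg_shift N.+1 (codom p) x0 h)).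
have Gp i : periodic G (N.+1%:R^-1 *: p i).
  move=> x; rewrite /G -[LHS](congr1 (fun f => f x) (gridavg_shift N.+1 (codom p) _ h)).
  by rewrite gridavg_step ?codom_f//; have [_] := th; exact.
(* [t] holds the coordinates of [x0] in grid steps; adding [z] rounds them down, so [z + x0] is a
   grid point. *)
pose t i := dot (b i) x0 * N.+1%:R.
pose z := \sum_i ((Num.floor (t i))%:~R - t i) *: (N.+1%:R^-1 *: p i).
have zx0 : z + x0 = 0 + \sum_i (N.+1%:R^-1 *: p i) *~ Num.floor (t i).
  rewrite add0r [in LHS](dual_basis_expansion x0) -big_split/=; apply: eq_bigr => i _.
  rewrite scalerBl scaler_int [t i *: _]scalerA /t mulfK ?pnatr_eq0//.
  by rewrite -addrA addNr addr0.
have -> : G 0 = G (z + x0).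
  rewrite zx0; elim/big_rec: _ => [|i y _ ->]; first by rewrite addr0.
  by rewrite !add0r [in RHS]addrC (periodicz (Gp i)).
rewrite -GE; apply: hN; apply: le_lt_trans sN.
rewrite /s mulr_suml; apply: le_trans (ler_norm_sum _ _ _) _.
apply: ler_sum => i _; rewrite !normrZ mulrA mulrC ler_wpM2l//.
rewrite [`|_^-1|]gtr0_norm ?invr_gt0// ger_pMl ?invr_gt0// ler_norml.
have := floor_itv (t i); rewrite intrD => /andP[? ?]; apply/andP; split; lra.
Qed.

(** The constants 1 make the function nonnegative, so that its powers preserve inequalities. *)
Definition peak x : R := \sum_i (1 + wave (b i) 0 x).

Lemma trig_poly_peak x0 : trig_poly (fun x => peak (x - x0)).
Proof.
rewrite (_ : (fun x => _) =
  \sum_i (fun x => 1 + wave (b i) (2 * pi * dot (b i) (- x0)) x)); last first.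
  apply/funext => x; rewrite fct_sumE; apply: eq_bigr => i _.
  by rewrite wave_shift add0r.
have t0 : trig_poly (fun=> 1) by rewrite -wave0; apply/trig_wave/lattice_span0.
elim/big_ind: _ => [|h g|i _]; [|exact: trig_add|].
  rewrite (_ : 0 = fun x => 0 * (fun=> 1) x); first exact: trig_scale.
  by apply/funext => x; rewrite mul0r.
by apply: trig_add => //; apply/trig_wave/lattice_span_basis.
Qed.

Lemma peak_ge0 x : 0 <= peak x.
Proof. by apply: sumr_ge0 => i _; rewrite -lerBlDl sub0r cos_geN1. Qed.

Lemma peak_le x : peak x <= n.+1%:R * 2.
Proof.
rewrite -[n.+1 in leRHS]card_ord mulr_natl -sumr_const; apply: ler_sum => i _.
by rewrite -[2]/(1 + 1) lerD2l cos_le1.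
Qed.

Lemma peak0 : peak 0 = n.+1%:R * 2.
Proof.
rewrite /peak (eq_bigr (fun=> 2)) => [|i _].
  by rewrite sumr_const card_ord mulr_natl.
by rewrite /wave dot0r mulr0 addr0 cos0.
Qed.

(** At the maximum every wave equals 1, so all coordinates are integers; those of a point of the box
    are at most 1/2 in absolute value. *)
Lemma peak_box_lt x : box x -> x != 0 -> peak x < n.+1%:R * 2.
Proof.
move=> [t ht xt] x0; rewrite lt_neqAle peak_le andbT; apply: contra x0 => /eqP px.
have /eqP : \sum_i (1 - wave (b i) 0 x) = 0.
  rewrite (eq_bigr (fun i => 2 - (1 + wave (b i) 0 x))) => [|i _]; last by lra.
  by rewrite sumrB -/(peak x) px sumr_const card_ord mulr_natl subrr.
rewrite psumr_eq0 => [/allP h|i _]; last by rewrite subr_ge0 cos_le1.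
rewrite xt big1// => i _.
have := h i (mem_index_enum i); rewrite /= subr_eq0 /wave addr0 => /eqP/esym/cos_eq1.
rewrite xt dot_sumr (bigD1 i)//= big1 => [|j ji]; last first.
  by rewrite dotZr bp eq_sym (negbTE ji) mulr0.
rewrite dotZr bp eqxx mulr1 addr0 => ti.
have [->|/(norm_intr_ge1 ti)] := eqVneq (t 0 i) 0; first by rewrite scale0r.
have := ht i; rewrite in_itv/= -ler_norml => t2 t1.
by have := le_trans t1 t2; rewrite leNgt invf_lt1 ?ltr1n.
Qed.

Lemma peak_far (e : R) : 0 < e -> exists q : R, [/\ 0 <= q, q < n.+1%:R * 2 &
  forall x, box x -> e <= `|x| -> peak x <= q].
Proof.
move=> e0; pose A := box `&` [set x | e <= `|x|].
have cA : compact A.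
  apply: compact_closedI; first exact: box_compact.
  apply: (@closed_comp _ _ (fun x : 'rV[R]_n.+1 => `|x|) [set y | e <= y]).
    by move=> x _; exact: norm_continuous.
  exact: closed_ge.
have [A0|/set0P A0] := eqVneq A set0.
  exists 0; split => // x bx ex.
  by suff : set0 x by []; rewrite -A0.
have [|y /set_mem[By ey] yA] := compact_EVT_max (f := peak) A0 cA.
  apply: continuous_subspaceT; have [+ _] := torus_fun_trig (trig_poly_peak 0).
  by under eq_fun do rewrite subr0.
exists (peak y); split; [exact: peak_ge0|apply: peak_box_lt => //|].
  by rewrite -normr_gt0 (lt_le_trans e0).
by move=> x bx ex; apply: yA; apply/mem_set.
Qed.

Lemma mean_trig_eq0 g h : torus_fun g -> trig_poly h ->
  (forall xi a, L xi -> M (g \* wave xi a) = 0) -> M (g \* h) = 0.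
Proof.
move=> tg th gw; elim: th => [xi a|h1 h2 t1 ih1 t2 ih2|a h1 t1 ih]; first exact: gw.
- rewrite (_ : _ \* _ = (g \* h1) \+ (g \* h2)); last first.
    by apply/funext => x /=; rewrite mulrDr.
  rewrite meanD ?ih1 ?ih2 ?addr0//; apply: torus_fun_bounded;
    by apply: torus_funM => //; exact: torus_fun_trig.
- rewrite (_ : _ \* _ = fun x => a * (g \* h1) x); last first.
    by apply/funext => x /=; rewrite mulrCA.
  rewrite meanZ ?ih ?mulr0//; apply: torus_fun_bounded.
  by apply: torus_funM => //; exact: torus_fun_trig.
Qed.

(** If [g x0 > 0], then in the mean of [g] times the [m]-th power of the peak at [x0], the part near
    [x0] grows at least like [q2 ^+ m], and the negative part at most like [q ^+ m] with [q < q2].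
    This mean is 0 for all [m], a contradiction. *)
Lemma fourier_le0 g : torus_fun g ->
  (forall xi a, L xi -> M (g \* wave xi a) = 0) -> forall x0, g x0 <= 0.
Proof.
move=> tg gw x0; rewrite leNgt; apply/negP => gx0; have [cg _] := tg.
pose c := g x0 / 2; have c0 : 0 < c by rewrite divr_gt0.
have [e e0 ge] : exists2 e : R, 0 < e & forall x, `|x - x0| < e -> c <= g x.
  have /cvgrPdist_lt /(_ c c0) /nbhs_normP[e e0 he] := cg x0.
  exists e => // x xe; have := he x; rewrite /ball_/= distrC => /(_ xe).
  by rewrite ltr_norml /c => /andP[_ ?]; lra.
have [q [q0 qT qfar]] := peak_far e0.
set T : R := n.+1%:R * 2 in qT; pose q2 := (q + T) / 2.
have T0 : 0 < T by rewrite mulr_gt0.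
have q20 : 0 < q2 by rewrite /q2; lra.
pose k x := peak (x - x0); have tk : trig_poly k by exact: trig_poly_peak.
have [ck pk] := torus_fun_trig tk.
(* Moved into the box around [x0], the point is either close to [x0] or where the peak is small. *)
have dich x : c <= g x \/ k x <= q.
  have [v Lv xv] := box_reduce (x - x0).
  rewrite -(torus_fun_lattice x tg Lv) -(torus_fun_lattice x (torus_fun_trig tk) Lv).
  rewrite /k addrAC; have [lt|le] := ltP `|x - x0 + v| e.
    by left; apply: ge; rewrite addrAC.
  by right; exact: qfar.
(* Twice the positive part of [k - q2]: a continuous function that vanishes unless [k > q2], hence
   unless [c <= g]. *)
pose phi x : R := `|k x - q2| + (k x - q2).
have tphi : torus_fun phi.
  split=> [x|i x]; last by rewrite /phi pk.
  have cq : {for x, continuous (fun x => k x - q2)}.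
    by apply: continuousB; [exact: ck|exact: cst_continuous].
  apply: (@continuousD _ _ _ (fun x => `|k x - q2|)) => //.
  by apply: (continuous_comp cq); exact: norm_continuous.
have phi0 x : 0 <= phi x by rewrite -lerBlDr sub0r ler_normr lexx orbT.
have phiT x : phi x <= 2 * T.
  have kT : k x <= T := peak_le (x - x0); have kx0 : 0 <= k x := peak_ge0 _.
  have : `|k x - q2| <= T by rewrite ler_norml; apply/andP; split; rewrite /q2; lra.
  by rewrite /phi; lra.
have Mphi : 0 < M phi.
  pose d := (T - q2) / 2; have d0 : 0 < d by rewrite /d /q2; lra.
  have /cvgrPdist_lt /(_ d d0) /nbhs_normP[e' e'0 he'] := ck x0.
  apply: (mean_gt0_near (x0 := x0) tphi phi0 e'0 d0) => x xe.
  have := he' x; rewrite /ball_/= distrC => /(_ xe).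
  rewrite /k subrr peak0 -/T -/(k x) ltr_norml => /andP[_ kd].
  have dE : d = (T - q2) / 2 by [].
  by rewrite /phi ger0_norm; lra.
have [B hB] := torus_fun_bounded tg.
have B0 : 0 <= B := le_trans (normr_ge0 _) (hB 0).
(* Where [k > q2], the bound [phi <= 2 * T] normalises the first term. Elsewhere [phi] is 0, and [g]
   can be negative only where [k <= q]. *)
have pointwise m x : c / (2 * T) * q2 ^+ m * phi x - B * q ^+ m <= g x * k x ^+ m.
  have kx0 : 0 <= k x := peak_ge0 _.
  have km : 0 <= k x ^+ m by rewrite exprn_ge0.
  have Bq : 0 <= B * q ^+ m by rewrite mulr_ge0// exprn_ge0.
  have [kq|kq] := leP (k x) q2.
    have -> : phi x = 0 by rewrite /phi ler0_norm ?addNr// subr_le0.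
    rewrite mulr0 sub0r; have [cgx|kxq] := dich x.
      rewrite (@le_trans _ _ 0) ?oppr_le0// mulr_ge0//.
      exact: le_trans (ltW c0) cgx.
    have gB : - B <= g x by have := hB x; rewrite ler_norml => /andP[].
    apply: le_trans (ler_wpM2r km gB); rewrite mulNr lerN2 ler_wpM2l//.
    exact: lerXn2r.
  have cgx : c <= g x by case: (dich x) => // kxq; rewrite /q2 in kq; lra.
  apply: (@le_trans _ _ (c * q2 ^+ m)).
    rewrite lerBlDr -[leLHS]addr0 lerD// mulrAC ler_wpM2r ?exprn_ge0 ?(ltW q20)//.
    by rewrite -mulrA ger_pMr// mulrC ler_pdivrMr ?mul1r// mulr_gt0.
  apply: ler_pM; rewrite ?exprn_ge0 ?(ltW c0) ?(ltW q20)//.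
  by rewrite lerXn2r ?nnegrE ?(ltW q20) ?(ltW kq).
clearbody phi.
have key m : c / (2 * T) * M phi <= B * (q / q2) ^+ m.
  rewrite expr_div_n [leRHS]mulrA ler_pdivlMr ?exprn_gt0// mulrAC.
  have tkm := trig_poly_exp m tk.
  have tg1 : torus_fun (g \* (fun x => k x ^+ m)).
    by apply: torus_funM => //; exact: torus_fun_trig.
  have tp := torus_funZ (- (c / (2 * T) * q2 ^+ m)) tphi.
  have tB := torus_fun_cst (B * q ^+ m).
  have := @mean_ge0 _ _ (codom p) ((g \* (fun x => k x ^+ m)) \+
    ((fun x => - (c / (2 * T) * q2 ^+ m) * phi x) \+ (fun=> B * q ^+ m))).
  rewrite meanD ?meanD ?(@meanZ _ _ _ _ phi) ?mean_cst ?mean_trig_eq0//;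
    try exact: torus_fun_bounded.
    rewrite add0r mulNr addrC subr_ge0; apply; last first.
      by move=> x /=; have := pointwise m x; lra.
    by apply: torus_fun_bounded; apply: torus_funD => //; exact: torus_funD.
  by apply: torus_fun_bounded; exact: torus_funD.
have q1 : `|q / q2| < 1.
  have qq2 : 0 <= q / q2 := divr_ge0 q0 (ltW q20).
  by rewrite ger0_norm// ltr_pdivrMr// mul1r /q2; lra.
have : c / (2 * T) * M phi <= 0.
  have Bq : B * (q / q2) ^+ m @[m --> \oo] --> (0 : R).
    by rewrite -(mulr0 B); apply: cvgMl_tmp; exact: cvg_expr.
  have cq : c / (2 * T) * M phi @[m --> \oo] --> c / (2 * T) * M phi.
    exact: cvg_cst.
  apply: (ler_cvg_to cq Bq).
  by apply: nearW => m; exact: key.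
by rewrite leNgt mulr_gt0// divr_gt0// mulr_gt0.
Qed.

Lemma fourier_uniqueness g : torus_fun g ->
  (forall xi a, L xi -> M (g \* wave xi a) = 0) -> g = fun=> 0.
Proof.
move=> tg gw; apply/funext => x; apply/eqP; rewrite eq_le fourier_le0//=.
rewrite -oppr_le0 -mulN1r; apply: (@fourier_le0 (fun x => -1 * g x)).
  exact: torus_funZ.
move=> xi a Lxi; rewrite (_ : _ \* _ = fun x => -1 * (g \* wave xi a) x).
  rewrite meanZ ?gw ?mulr0//; apply: torus_fun_bounded.
  by apply: torus_funM => //; exact: torus_fun_wave.
by apply/funext => y /=; rewrite mulrA.
Qed.

Lemma fourier_inj g h : torus_fun g -> torus_fun h ->
  (forall xi a, L xi -> M (g \* wave xi a) = M (h \* wave xi a)) -> g = h.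
Proof.
move=> tg th gh; have tN := torus_funZ (-1) th.
have : g \+ (fun x => -1 * h x) = fun=> 0.
  apply: fourier_uniqueness => [|xi a Lxi]; first exact: torus_funD.
  have tw := torus_fun_wave a Lxi.
  rewrite (_ : _ \* _ = (g \* wave xi a) \+ (fun x => -1 * (h \* wave xi a) x)).
    have tghw := torus_funM th tw.
    rewrite meanD ?meanZ ?gh ?mulN1r ?subrr//; apply: torus_fun_bounded => //.
      exact: torus_funM.
    exact: torus_funZ.
  by apply/funext => x /=; ring.
move=> E; apply/funext => x; apply/eqP; rewrite -subr_eq0 -mulN1r.
by apply/eqP; exact: (congr1 (fun f => f x) E).
Qed.

End Lattice.

(** * Minimal maps are Laplace eigenmaps *)

Section SmoothMaps.
Context {R : realType} {n N : nat}.
Implicit Types (F G : 'rV[R]_n.+1 -> 'rV[R]_N.+1) (x v w : 'rV[R]_n.+1).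

Lemma smooth_differentiable F x : smooth F -> differentiable F x.
Proof. by move=> /(_ 1%N) [+ _]; apply. Qed.

Lemma smooth_derive F v : smooth F -> smooth (fun x => 'D_v F x).
Proof. by move=> sF k; have [_] := sF k.+1; apply. Qed.

Lemma is_derive_coord F v x (k : 'I_N.+1) : differentiable F x ->
  is_derive x v (fun y => F y 0 k) ('D_v F x 0 k).
Proof.
move=> dF; have dv : derivable F x v by exact: diff_derivable.
rewrite derive_mx// mxE; apply: derivableP.
by move/derivable_mxP : dv; apply.
Qed.

Lemma derive_periodic F v p : periodic F p -> periodic (fun x => 'D_v F x) p.
Proof.
move=> Fp x; rewrite /derive Fp (_ : F \o shift (x + p) = F \o shift x)//.
by apply/funext => h /=; rewrite addrA Fp.
Qed.

Lemma is_derive_dot F G v x : differentiable F x -> differentiable G x ->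
  is_derive x v (fun y => dot (F y) (G y))
    (dot ('D_v F x) (G x) + dot (F x) ('D_v G x)).
Proof.
move=> dF dG; rewrite (_ : (fun y => _) =
    \sum_(k < N.+1) ((fun y => F y 0 k) \* (fun y => G y 0 k))); last first.
  by apply/funext => y; rewrite fct_sumE.
apply: is_derive_eq.
  apply: is_derive_sum => k; apply: is_deriveM; exact: is_derive_coord.
rewrite /dot -big_split/=; apply: eq_bigr => k _.
by rewrite addrC; congr (_ + _); exact: mulrC.
Qed.

Lemma derive_dot_cst F G v x (c : R) : differentiable F x -> differentiable G x ->
  (forall y, dot (F y) (G y) = c) ->
  dot ('D_v F x) (G x) + dot (F x) ('D_v G x) = 0.
Proof.
move=> dF dG FG; have [_ <-] := is_derive_dot v dF dG.
by rewrite (funext FG); exact: derive_cst.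
Qed.

End SmoothMaps.

Section TorusMap.
Context {R : realType} {n N : nat} (b p : 'I_n.+1 -> 'rV[R]_n.+1).
Hypothesis bp : forall i j, dot (b i) (p j) = (i == j)%:R.
Implicit Types (F G : 'rV[R]_n.+1 -> 'rV[R]_N.+1) (x v w xi : 'rV[R]_n.+1).
Implicit Types (k : 'I_N.+1) (a : R).

Local Notation L := (lattice_span b).
Local Notation M := (mean (codom p)).

Definition torus_map F := smooth F /\ forall i, periodic F (p i).

Lemma torus_map_derive F v : torus_map F -> torus_map (fun x => 'D_v F x).
Proof.
by move=> [sF pF]; split=> [|i]; [exact: smooth_derive|exact: derive_periodic].
Qed.

Lemma torus_map_coord F k : torus_map F -> torus_fun p (fun x => F x 0 k).
Proof.
move=> [sF pF]; split=> [x|i x]; last by rewrite pF.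
have cF : {for x, continuous F}.
  exact/differentiable_continuous/smooth_differentiable.
apply: (@continuous_comp _ _ _ F (fun A : 'rV[R]_N.+1 => A 0 k)) => //.
exact: coord_continuous.
Qed.

Lemma derive_expansion F v x : differentiable F x ->
  'D_v F x = \sum_i dot (b i) v *: 'D_(p i) F x.
Proof.
move=> dF; rewrite [in LHS](dual_basis_expansion bp v) deriveE// linear_sum.
by apply: eq_bigr => i _; rewrite linearZ/= deriveE.
Qed.

(** Integration by parts is known along the periods [p i]; linearity of the differential extends it
    to any direction. *)
Lemma mean_ibp_map F v xi a k : torus_map F -> L xi ->
  M ((fun x => 'D_v F x 0 k) \* wave xi a) =
    - (2 * pi * dot xi v) * M ((fun x => F x 0 k) \* wave xi (a + pi / 2)).
Proof.
move=> tF Lxi; have [sF _] := tF.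
have tw c := torus_fun_wave bp c Lxi.
rewrite (_ : _ \* wave xi a = fun x => \sum_i dot (b i) v *
    ((fun x => 'D_(p i) F x 0 k) \* wave xi a) x); last first.
  apply/funext => x /=; rewrite derive_expansion; last exact: smooth_differentiable.
  rewrite summxE mulr_suml; apply: eq_bigr => i _; by rewrite mxE mulrA.
have tD i : torus_fun p ((fun x => 'D_(p i) F x 0 k) \* wave xi a).
  by apply: torus_funM => //; exact/torus_map_coord/torus_map_derive.
have ibp i : M ((fun x => 'D_(p i) F x 0 k) \* wave xi a) =
    - (2 * pi * dot xi (p i)) * M ((fun x => F x 0 k) \* wave xi (a + pi / 2)).
  have sF1 := smooth_derive (p i) sF.
  have t1 := torus_map_derive (p i) tF; have t2 := torus_map_derive (p i) t1.
  have d0 x : is_derive x (p i) (fun y => F y 0 k) ('D_(p i) F x 0 k).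
    by apply: is_derive_coord; exact: smooth_differentiable.
  have d1 x : is_derive x (p i) (fun y => 'D_(p i) F y 0 k)
      ('D_(p i) (fun y => 'D_(p i) F y) x 0 k).
    by apply: is_derive_coord; exact: smooth_differentiable.
  exact: (mean_ibp bp a (torus_map_coord k tF) (torus_map_coord k t1)
    (torus_map_coord k t2) d0 d1 Lxi).
rewrite (mean_sum bp) => [|i]; last exact: torus_funZ.
rewrite [in RHS](dual_basis_expansion bp v) dot_sumr mulr_sumr -sumrN mulr_suml.
apply: eq_bigr => i _; rewrite meanZ; last exact: (torus_fun_bounded bp).
by rewrite ibp dotZr; ring.
Qed.

Lemma mean_ibp_map2 F v w xi a k : torus_map F -> L xi ->
  M ((fun x => 'D_v (fun y => 'D_w F y) x 0 k) \* wave xi a) =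
    - ((2 * pi) ^+ 2 * (dot xi v * dot xi w)) * M ((fun x => F x 0 k) \* wave xi a).
Proof.
move=> tF Lxi; rewrite mean_ibp_map//; last exact: torus_map_derive.
rewrite mean_ibp_map// (_ : _ \* wave xi (a + pi / 2 + pi / 2) =
    fun x => -1 * ((fun x => F x 0 k) \* wave xi a) x); last first.
  by apply/funext => x /=; rewrite -addrA -splitr waveDpi; ring.
rewrite meanZ; first by ring.
apply: (torus_fun_bounded bp); apply: torus_funM; first exact: torus_map_coord.
exact: torus_fun_wave.
Qed.

(* The symmetry of second derivatives is read off the Fourier coefficients. *)
Lemma derive_comm F v w x : torus_map F ->
  'D_v (fun y => 'D_w F y) x = 'D_w (fun y => 'D_v F y) x.
Proof.
move=> tF; apply/rowP => k; move: x.
suff : (fun x => 'D_v (fun y => 'D_w F y) x 0 k) =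
    (fun x => 'D_w (fun y => 'D_v F y) x 0 k).
  by move=> E x; exact: (congr1 (fun f => f x) E).
have t2 v' w' := torus_map_coord k (torus_map_derive v' (torus_map_derive w' tF)).
apply: (fourier_inj bp (t2 v w) (t2 w v)) => xi a Lxi.
apply: etrans (mean_ibp_map2 v w a k tF Lxi) _; rewrite (mulrC (dot xi v)).
by apply: esym; exact: mean_ibp_map2.
Qed.

Definition laplacian F x : 'rV[R]_N.+1 := \sum_i partial i (partial i F) x.

Lemma mean_laplacian F xi a k : torus_map F -> L xi ->
  M ((fun x => laplacian F x 0 k) \* wave xi a) =
    - ((2 * pi) ^+ 2 * dot xi xi) * M ((fun x => F x 0 k) \* wave xi a).
Proof.
move=> tF Lxi; rewrite (_ : _ \* wave xi a = fun x =>
    \sum_i ((fun x => partial i (partial i F) x 0 k) \* wave xi a) x); last first.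
  by apply/funext => x /=; rewrite /laplacian summxE mulr_suml.
rewrite (mean_sum bp) => [|i]; last first.
  apply: torus_funM; last exact: torus_fun_wave.
  exact/torus_map_coord/torus_map_derive/torus_map_derive.
rewrite [in RHS]/dot mulr_sumr -sumrN mulr_suml; apply: eq_bigr => i _.
by rewrite mean_ibp_map2// dot_delta.
Qed.

Section Takahashi.
Variables (F : 'rV[R]_n.+1 -> 'rV[R]_N.+1) (c : R).
Hypotheses (tF : torus_map F) (c0 : 0 < c).
Hypothesis sphF : forall x, dot (F x) (F x) = 1.
Hypothesis isoF : forall x, induced_metric F x = c%:M.

Let dF x : differentiable F x.
Proof. by apply: smooth_differentiable; case: tF. Qed.

Let d1F i x : differentiable (partial i F) x.
Proof.
by apply: smooth_differentiable; have [] := torus_map_derive (delta_mx 0 i) tF.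
Qed.

Lemma row_jacobian i x : row i ('J F x) = partial i F x.
Proof. by rewrite rowE /partial deriveEjacobian. Qed.

Lemma isometric_dot i j x : dot (partial i F x) (partial j F x) = c *+ (i == j).
Proof.
rewrite -!row_jacobian; have /matrixP/(_ i j) := isoF x; rewrite !mxE => <-.
by apply: eq_bigr => k _; rewrite !mxE.
Qed.

Lemma tangent_dot i x : dot (F x) (partial i F x) = 0.
Proof.
have := derive_dot_cst (delta_mx 0 i) (dF x) (dF x) sphF.
rewrite dotC -mulr2n => /eqP; rewrite mulrn_eq0/= => /eqP; exact.
Qed.

Lemma second_derivative_dot i x : dot (F x) (partial i (partial i F) x) = - c.
Proof.
have := derive_dot_cst (delta_mx 0 i) (dF x) (d1F i x) (tangent_dot i).
rewrite isometric_dot eqxx mulr1n => /eqP.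
by rewrite addrC addr_eq0 => /eqP.
Qed.

(* Koszul's computation: the first Christoffel symbols of a constant metric
   vanish. *)
Lemma christoffel_eq0 i j l x :
  dot (partial i (partial j F) x) (partial l F x) = 0.
Proof.
have skew i' j' l' : dot (partial i' (partial j' F) x) (partial l' F x) =
    - dot (partial i' (partial l' F) x) (partial j' F x).
  have := derive_dot_cst (delta_mx 0 i') (d1F j' x) (d1F l' x) (isometric_dot j' l').
  by rewrite (dotC (partial j' F x)) => /eqP; rewrite addr_eq0 => /eqP.
have sym i' j' : partial i' (partial j' F) x = partial j' (partial i' F) x.
  exact: derive_comm.
have koszul (G : 'I_n.+1 -> 'I_n.+1 -> 'I_n.+1 -> R) :
    (forall i j l, G i j l = - G i l j) -> (forall i j l, G i j l = G j i l) ->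
    G i j l = 0.
  (* Alternating the two symmetries runs through the six orders of the indices and returns with the
     opposite sign. *)
  move=> sk sy; have := sk i j l; rewrite (sy i l j) (sk l i j) (sy l j i) (sk j l i).
  by rewrite (sy j i l); lra.
apply: (koszul (fun i j l => dot (partial i (partial j F) x) (partial l F x)) skew).
move=> i' j' l'.
exact (congr1 (fun u => dot u (partial l' F x)) (sym i' j')).
Qed.

(** The inverse metric being scalar, minimality says that the Laplacian has no normal part, so it
    lies in the row space of [A]. The difference of the two sides is then both in this space and
    orthogonal to it, by the products computed above. *)
Lemma laplacian_eigen : (forall x, mean_curvature F x = 0) ->
  forall x, laplacian F x = - (n.+1%:R * c) *: F x.
Proof.
move=> minF x; set A := col_mx (F x) ('J F x).
have AP (u : 'rV[R]_N.+1) : (u <= A)%MS -> u *m A^T = 0 -> u = 0.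
  move=> /submxP[z uz] uA; apply/eqP; rewrite -dot_eq0 dotE {2}uz trmx_mul mulmxA.
  by rewrite uA mul0mx mxE.
have mulA (u : 'rV[R]_N.+1) : dot (F x) u = 0 ->
    (forall i, dot (partial i F x) u = 0) -> u *m A^T = 0.
  move=> uF uJ; rewrite /A tr_col_mx mul_mx_row.
  rewrite (_ : u *m (F x)^T = 0); last first.
    by apply/matrixP => i j; rewrite !ord1 -dotE dotC uF mxE.
  rewrite (_ : u *m ('J F x)^T = 0) ?row_mx0//.
  apply/matrixP => i j; rewrite ord1 [RHS]mxE -(uJ j) -row_jacobian dotC dotE.
  by rewrite !mxE; apply: eq_bigr => k _; rewrite !mxE.
(* [proj_mx] is the expected projection because the two spaces are complementary; positivity of
   [dot] makes them disjoint. *)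
have cap0 : (kermx A^T :&: <<A>>)%MS = 0.
  apply/eqP/rowV0P => u; rewrite sub_capmx genmxE => /andP[/sub_kermxP uA uA'].
  exact: AP.
have full : row_full (kermx A^T + <<A>>)%MS.
  rewrite /row_full mxrank_disjoint_sum// mxrank_ker mxrank_gen mxrank_tr subnK//.
  exact: rank_leq_col.
have lapA : (laplacian F x <= A)%MS.
  have : laplacian F x *m normal_proj F x = 0.
    have := minF x; rewrite /mean_curvature isoF invmx_scalar => /eqP.
    rewrite scaler_eq0 invr_eq0 pnatr_eq0/= => /eqP h.
    apply/eqP; rewrite -(inj_eq (scalerI (_ : c^-1 != 0))) ?invr_eq0 ?gt_eqF//.
    rewrite scaler0 -[X in _ == X]h mulmx_suml scaler_sumr; apply/eqP.
    apply: eq_bigr => i _; rewrite (bigD1 i)//= big1 => [|j ji].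
      by rewrite addr0 mxE eqxx mulr1n.
    by rewrite mxE eq_sym (negbTE ji) mulr0n scale0r.
  rewrite /normal_proj -/A => lap0.
  have := add_proj_mx cap0 (submx_full (laplacian F x) full).
  rewrite lap0 add0r => <-; rewrite (submx_trans (proj_mx_sub _ _ _))// genmxE//.
apply/eqP; rewrite scaleNr -addr_eq0; apply/eqP; apply: AP.
  apply: addmx_sub => //; apply: scalemx_sub.
  by rewrite /A -addsmxE addsmxSl.
apply: mulA => [|i]; rewrite dotDr dotZr /laplacian dot_sumr.
  rewrite (eq_bigr (fun=> - c)) => [|i _]; last exact: second_derivative_dot.
  by rewrite sumr_const card_ord sphF mulr1 mulr_natl mulNrn addNr.
rewrite big1 => [|j _]; last by rewrite dotC christoffel_eq0.
by rewrite dotC tangent_dot mulr0 addr0.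
Qed.

(** The Laplacian multiplies a Fourier coefficient by one factor by parts and by another by the
    eigenvalue equation; on a nonzero coefficient they agree. *)
Lemma eigen_spectrum xi a k : (forall x, mean_curvature F x = 0) -> L xi ->
  M ((fun x => F x 0 k) \* wave xi a) != 0 ->
  (2 * pi) ^+ 2 * dot xi xi = n.+1%:R * c.
Proof.
move=> minF Lxi M0; have := mean_laplacian a k tF Lxi.
rewrite (_ : _ \* _ = fun x => - (n.+1%:R * c) * ((fun x => F x 0 k) \* wave xi a) x).
  rewrite meanZ; first by move=> /(mulIf M0)/oppr_inj.
  apply: (torus_fun_bounded bp); apply: torus_funM; first exact: torus_map_coord.
  exact: torus_fun_wave.
by apply/funext => x /=; rewrite laplacian_eigen// mxE mulrA.
Qed.

End Takahashi.

(** * Finite Fourier expansions *)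

Lemma mean_waveM xi eta a c : L xi -> L eta -> xi + eta != 0 ->
  M (wave xi a \* wave eta c) = (2^-1 * cos (a - c)) *+ (xi == eta).
Proof.
move=> Lxi Leta xe0; have [LD LB] := (lattice_spanD Lxi Leta, lattice_spanB Lxi Leta).
have bw a' zeta : L zeta -> unif_bounded (wave zeta a').
  by move=> Lz; apply: (torus_fun_bounded bp); exact: torus_fun_wave.
have bwZ a' zeta : L zeta -> unif_bounded (fun x => 2^-1 * wave zeta a' x).
  by move=> Lz; apply: (torus_fun_bounded bp); apply: torus_funZ; exact: torus_fun_wave.
rewrite waveM meanD ?(bwZ _ _ LD) ?(bwZ _ _ LB)//; try exact: bwZ.
rewrite !meanZ; try exact: bw.
rewrite (mean_wave0 bp)// mulr0 add0r; case: eqVneq => [->|xe]; last first.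
  by rewrite mulr0n (mean_wave0 bp) ?mulr0// subr_eq0.
rewrite subrr mulr1n (_ : wave 0 _ = fun=> cos (a - c)) ?mean_cst//.
by apply/funext => x; rewrite /wave dot0l mulr0 add0r.
Qed.

(** The component of [h] at the frequencies [xi] and [- xi] when [xi] is nonzero; the factor 2 is
    there because a squared wave has mean 1/2. *)
Definition fourier_term (h : 'rV[R]_n.+1 -> R) xi x : R :=
  2 * M (h \* wave xi 0) * wave xi 0 x +
  2 * M (h \* wave xi (- (pi / 2))) * wave xi (- (pi / 2)) x.

Lemma torus_fun_fourier_term h xi : L xi -> torus_fun p (fourier_term h xi).
Proof.
move=> Lxi; apply: (@torus_funD _ _ _ (fun x => _ * wave xi 0 x)
    (fun x => _ * wave xi (- (pi / 2)) x));
  by apply: torus_funZ; exact: torus_fun_wave.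
Qed.

Lemma mean_fourier_term h xi eta a : torus_fun p h -> L xi -> L eta -> xi + eta != 0 ->
  M (fourier_term h xi \* wave eta a) = M (h \* wave eta a) *+ (xi == eta).
Proof.
move=> th Lxi Leta xe.
have tw zeta c : L zeta -> torus_fun p (wave zeta c) by exact: torus_fun_wave.
have tww c : torus_fun p (wave xi c \* wave eta a) by apply: torus_funM; exact: tw.
have bww c := torus_fun_bounded bp (tww c).
have bwwZ d c := torus_fun_bounded bp (torus_funZ d (tww c)).
rewrite (_ : _ \* _ =
    (fun x => 2 * M (h \* wave xi 0) * (wave xi 0 \* wave eta a) x) \+
    (fun x => 2 * M (h \* wave xi (- (pi / 2))) *
      (wave xi (- (pi / 2)) \* wave eta a) x)); last first.
  by apply/funext => x; rewrite /fourier_term /=; ring.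
rewrite meanD// !meanZ// !mean_waveM//; case: eqVneq => [<-|_]; last first.
  by rewrite !mulr0n !mulr0 addr0.
rewrite !mulr1n (_ : h \* wave xi a = (fun x => cos a * (h \* wave xi 0) x) \+
    (fun x => - sin a * (h \* wave xi (- (pi / 2))) x)); last first.
  by apply/funext => x; rewrite /= (wave_phase xi a); ring.
have bhw c : unif_bounded (h \* wave xi c).
  by apply: (torus_fun_bounded bp); apply: torus_funM => //; exact: tw.
have bhwZ d c : unif_bounded (fun x => d * (h \* wave xi c) x).
  apply: (torus_fun_bounded bp); apply: torus_funZ; apply: torus_funM => //.
  exact: tw.
rewrite meanD// !meanZ// sub0r cosN.
rewrite (_ : - (pi / 2) - a = - (a + pi / 2)); last by rewrite opprD addrC.
rewrite cosN cosDpihalf.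
by field.
Qed.

(** The condition on sums keeps 0 out of [s] and allows one vector of each pair [xi], [- xi]. Both
    sides have the same coefficients at [eta], whether [eta], [- eta] or neither lies in [s]. *)
Lemma fourier_expansion (s : seq 'rV[R]_n.+1) h : torus_fun p h -> uniq s ->
  {in s, forall xi, L xi} ->
  {in s &, forall xi eta, xi + eta != 0} ->
  (forall xi a, L xi -> M (h \* wave xi a) != 0 -> (xi \in s) || (- xi \in s)) ->
  h = fun x => \sum_(xi <- s) fourier_term h xi x.
Proof.
move=> th us sL sN spec.
have tsum : torus_fun p (fun x => \sum_(xi <- s) fourier_term h xi x).
  rewrite (_ : (fun x => _) = \sum_(xi <- s) fourier_term h xi); last first.
    by apply/funext => x; rewrite fct_sumE.
  rewrite big_seq; elim/big_ind: _ => [|f g|xi xis].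
  - exact: torus_fun_cst.
  - exact: torus_funD.
  - exact/torus_fun_fourier_term/sL.
apply: (fourier_inj bp) => // eta a Leta.
have expand zeta c : L zeta -> {in s, forall xi, xi + zeta != 0} ->
    M ((fun x => \sum_(xi <- s) fourier_term h xi x) \* wave zeta c) =
    \sum_(xi <- s) M (h \* wave zeta c) *+ (xi == zeta).
  (* [mean_sum] asks for a torus function at every index, so the terms off [s] are replaced by 0. *)
  move=> Lz sz; rewrite (_ : _ \* _ = fun x => \sum_(xi <- s)
      (if xi \in s then fourier_term h xi \* wave zeta c else fun=> 0) x); last first.
    apply/funext => x /=; rewrite mulr_suml big_seq [RHS]big_seq.
    by apply: eq_bigr => xi ->.
  rewrite (mean_sum bp) => [|xi]; last first.
    case: ifP => [xis|_]; last exact: torus_fun_cst.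
    apply: torus_funM; [exact/torus_fun_fourier_term/sL|exact: torus_fun_wave].
  rewrite big_seq [RHS]big_seq; apply: eq_bigr => xi xis; rewrite xis.
  by apply: mean_fourier_term => //; [exact: sL|exact: sz].
have in_s zeta c : zeta \in s -> L zeta ->
    M ((fun x => \sum_(xi <- s) fourier_term h xi x) \* wave zeta c) =
    M (h \* wave zeta c).
  move=> zs Lz; rewrite expand// => [|xi xis]; last exact: sN.
  rewrite (bigD1_seq zeta)//= eqxx big1 ?addr0// => xi xz.
  by rewrite (negbTE xz).
have [es|es] := boolP (eta \in s); first by rewrite in_s.
have [nes|nes] := boolP (- eta \in s).
  by rewrite -[eta]opprK waveNl in_s//; exact: lattice_spanN.
have h0 : M (h \* wave eta a) = 0.
  apply/eqP; apply: contraNT es => /(spec _ _ Leta).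
  by rewrite (negbTE nes) orbF.
rewrite h0 expand// => [|xi xis].
  by rewrite big1// => xi _; rewrite h0 mul0rn.
by rewrite addr_eq0; apply: contraNneq nes => <-.
Qed.

End TorusMap.

(** * Full maps with prescribed spectrum *)

Section TorusTopology.
Context {R : realType} {n : nat} (b p : 'I_n.+1 -> 'rV[R]_n.+1).
Hypothesis bp : forall i j, dot (b i) (p j) = (i == j)%:R.

Local Notation L := (lattice_span b).
Local Open Scope quotient_scope.

Lemma torus_pi_eq (x y : 'rV[R]_n.+1) :
  \pi_(flat_torus L) x = \pi_(flat_torus L) y <-> dual_lattice L (x - y).
Proof.
split=> [/eqmodP/asboolP//|xy]; exact/eqmodP/asboolP.
Qed.

Lemma dual_lattice_span v : lattice_span p v -> dual_lattice L v.
Proof.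
move=> [c ->] xi Lxi; rewrite dot_suml rpred_sum// => i _.
rewrite -scaler_int dotZl rpredM ?intr_int//; exact: (dual_lattice_basis bp).
Qed.

Lemma periodic_lift_periodic T (f : flat_torus L -> T) (x : 'rV[R]_n.+1) i :
  periodic_lift f (x + p i) = periodic_lift f x.
Proof.
congr f; apply/torus_pi_eq; rewrite addrAC subrr add0r.
exact: (dual_lattice_basis bp).
Qed.

Lemma flat_torus_compact : compact [set: flat_torus L].
Proof.
rewrite (_ : setT = \pi_(flat_torus L) @` box p).
  apply: continuous_compact; last exact: box_compact.
  apply: continuous_subspaceT; exact: pi_continuous.
apply/seteqP; split=> // t _; have [v Lv xv] := box_reduce bp (repr t).
exists (repr t + v) => //; rewrite -[RHS]reprK; apply/torus_pi_eq.
by rewrite addrAC subrr add0r; exact: dual_lattice_span.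
Qed.

Lemma injective_homeo_onto_image N (f : flat_torus L -> 'rV[R]_N.+1) :
  continuous (periodic_lift f) -> injective f -> homeo_onto_image f.
Proof.
move=> cf injf.
have cf' : continuous f by exact/quotient_continuous.
(* The complement of [U] is compact, so its image is closed; by injectivity the image of [U] is the
   rest of the range. *)
split=> // U oU; exists (~` (f @` ~` U)).
  apply: closed_openC; apply: compact_closed; first exact: norm_hausdorff.
  apply: continuous_compact; first exact: continuous_subspaceT.
  apply: (subclosed_compact _ flat_torus_compact) => //; exact: open_closedC.
apply/seteqP; split=> [y [t Ut <-]|y [ny [t _ ty]]].
  by split; [move=> [t' nUt' /injf tt']; apply: nUt'; rewrite tt'|exists t].
exists t => //; apply: contrapT => nUt; apply: ny; by exists t.
Qed.

End TorusTopology.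

Section FullMaps.
Context {R : realType} {n N m : nat} (L : set 'rV[R]_n.+1).

Lemma full_row_full (f : flat_torus L -> 'rV[R]_N.+1) (W : 'M[R]_(m, N.+1))
    (w : flat_torus L -> 'rV[R]_m) :
  (forall t, f t = w t *m W) -> full f -> row_full W.
Proof.
move=> fE fullf; pose X := [tuple row i W | i < m].
have spanX v : v \in <<X>>%VS -> (v <= W)%MS.
  move=> /coord_span ->; apply: summx_sub => i _; apply: scalemx_sub.
  by rewrite nth_mktuple row_sub.
have XT : <<X>>%VS = fullv.
  apply: fullf => t; rewrite fE mulmx_sum_row; apply: memv_suml => i _.
  by apply/memvZ/memv_span; apply/tnthP; exists i; rewrite tnth_mktuple.
rewrite -sub1mx; apply/row_subP => i; apply: spanX; rewrite XT; exact: memvf.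
Qed.

End FullMaps.

Section Spectrum.
Context {R : realType} {n N : nat} (b p : 'I_n.+1 -> 'rV[R]_n.+1).
Hypothesis bp : forall i j, dot (b i) (p j) = (i == j)%:R.
Local Notation L := (lattice_span b).
Local Notation M := (mean (codom p)).

Variables (f : flat_torus L -> 'rV[R]_N.+1) (s : seq 'rV[R]_n.+1).
Hypotheses (tf : torus_map p (periodic_lift f)) (full_f : full f).
Hypotheses (us : uniq s) (sL : {in s, forall xi, L xi}).
Hypothesis sN : {in s &, forall xi eta, xi + eta != 0}.
Hypothesis spec : forall (k : 'I_N.+1) xi a, L xi ->
  M ((fun x => periodic_lift f x 0 k) \* wave xi a) != 0 ->
  (xi \in s) || (- xi \in s).

(** Cosines fill the first block and sines the second, so that the lift factors through a linear
    map, [coefs]. *)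
Let waves (x : 'rV[R]_n.+1) : 'rV[R]_(size s + size s) :=
  row_mx (\row_(i < size s) wave s`_i 0 x)
         (\row_(i < size s) wave s`_i (- (pi / 2)) x).

Let coefs : 'M[R]_(size s + size s, N.+1) :=
  col_mx (\matrix_(i, k) (2 * M ((fun x => periodic_lift f x 0 k) \* wave s`_i 0)))
    (\matrix_(i, k) (2 * M ((fun x => periodic_lift f x 0 k) \*
                            wave s`_i (- (pi / 2))))).

Let liftE x : periodic_lift f x = waves x *m coefs.
Proof.
rewrite mul_row_col; apply/rowP => k; rewrite !mxE -big_split/=.
have := fourier_expansion bp (torus_map_coord k tf) us sL sN (spec (k := k)).
move=> /(congr1 (fun h => h x)) ->; rewrite (big_nth 0) big_mkord.
by apply: eq_bigr => i _; rewrite !mxE /fourier_term; congr (_ + _); exact: mulrC.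
Qed.

Let coefs_full : row_full coefs.
Proof.
apply: (full_row_full (f := f) (w := fun t => waves (repr t))) => // t.
by rewrite -liftE /periodic_lift reprK.
Qed.

Lemma full_spectrum_size : (N.+1 <= 2 * size s)%N.
Proof.
have /eqP <- := coefs_full; rewrite mul2n -addnn; exact: rank_leq_row.
Qed.

(** [coefs] is now square of full rank, so [x] and [y] have the same cosines and sines, and the
    cosine of each phase difference is a sum of squares equal to 1. *)
Lemma full_spectrum_separates x y : N.+1 = (2 * size s)%N ->
  periodic_lift f x = periodic_lift f y ->
  {in s, forall xi, dot xi (x - y) \is a Num.int}.
Proof.
move=> Ns; rewrite !liftE => fxy xi xis.
have free : row_free coefs.
  by have /eqP rk := coefs_full; rewrite /row_free rk addnn -mul2n -Ns.
have /eq_row_mx[/rowP wc /rowP ws] := row_free_inj free fxy.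
have si : (index xi s < size s)%N by rewrite index_mem.
have := wc (Ordinal si); have := ws (Ordinal si).
rewrite !mxE/= nth_index// /wave !cosBpihalf !addr0 => sxy cxy.
by apply: cos_eq1; rewrite dotBr mulrBr cosB cxy sxy -!expr2 cos2Dsin2.
Qed.

End Spectrum.

(** * Sums of two squares *)

Section NumberTheory.
Local Open Scope ring_scope.
Implicit Types (x y u v : int) (r : nat).

Lemma prime_dvdzM r x y : prime r -> (r %| x * y)%Z -> (r %| x)%Z || (r %| y)%Z.
Proof. by move=> pr; rewrite !dvdzE abszM Euclid_dvdM. Qed.

Lemma odd_sqr r : odd r -> r%:Z ^+ 2 = 4 * (r./2%:Z ^+ 2 + r./2%:Z) + 1.
Proof.
move=> r_odd; rewrite [in LHS](_ : r = (r./2 * 2 + 1)%N); last by lia.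
by rewrite PoszD PoszM; ring.
Qed.

Lemma sqr_sum_le r x y : x ^+ 2 + y ^+ 2 = r%:Z ^+ 2 -> - r%:Z <= x <= r%:Z.
Proof. by move=> xy; nia. Qed.

Lemma sqr_sum_lt r x y : x ^+ 2 + y ^+ 2 = r%:Z ^+ 2 -> y != 0 ->
  (absz x < r)%N.
Proof. by move=> xy y0; nia. Qed.

Lemma sqr_sum_ndvd r x y : x ^+ 2 + y ^+ 2 = r%:Z ^+ 2 -> x * y != 0 ->
  ~~ (r %| x)%Z /\ ~~ (r %| y)%Z.
Proof.
rewrite mulf_eq0 negb_or => xy /andP[x0 y0].
have ndvd z t : z ^+ 2 + t ^+ 2 = r%:Z ^+ 2 -> z != 0 -> t != 0 -> ~~ (r %| z)%Z.
  move=> zt z0 t0; rewrite dvdzE gtnNdvd ?absz_gt0//; exact: sqr_sum_lt zt t0.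
by split; [exact: ndvd xy _ _|rewrite addrC in xy; exact: ndvd xy _ _].
Qed.

Lemma sqr_sum_prod r x y u v :
  x ^+ 2 + y ^+ 2 = r%:Z ^+ 2 -> u ^+ 2 + v ^+ 2 = r%:Z ^+ 2 ->
  (x * v - y * u) * (x * v + y * u) = r%:Z ^+ 2 * (x ^+ 2 - u ^+ 2).
Proof.
move=> xy uv; transitivity (x ^+ 2 * (u ^+ 2 + v ^+ 2) - u ^+ 2 * (x ^+ 2 + y ^+ 2)).
  by ring.
by rewrite xy uv; ring.
Qed.

(* [r^2] divides [(x v - y u) (x v + y u) = r^2 (x^2 - u^2)], hence the factor
   divisible by [r], which is at most [r^2] in absolute value. *)
Lemma sqr_sum_dvd r x y u v : prime r ->
  x ^+ 2 + y ^+ 2 = r%:Z ^+ 2 -> u ^+ 2 + v ^+ 2 = r%:Z ^+ 2 ->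
  (r %| x * v - y * u)%Z -> ~~ (r %| x * v + y * u)%Z ->
  u ^+ 2 = x ^+ 2 \/ u ^+ 2 = y ^+ 2.
Proof.
move=> pr xy uv /dvdzP[A AE] nB; have r0 : r%:Z != 0 by have := prime_gt0 pr; lia.
have vE : v ^+ 2 = r%:Z ^+ 2 - u ^+ 2 by rewrite -uv addrAC subrr add0r.
have prod := sqr_sum_prod xy uv.
have : (r %| A * (x * v + y * u))%Z.
  apply/dvdzP; exists (x ^+ 2 - u ^+ 2); apply: (mulfI r0).
  by rewrite mulrCA mulrA (mulrC _ r%:Z) (mulrC r%:Z A) -AE prod; ring.
move=> /(prime_dvdzM pr); rewrite (negbTE nB) orbF => /dvdzP[A' A'E].
(* Brahmagupta's identity bounds the cofactor [A'] by 1 in absolute value. If it is 0, then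
   [u ^+ 2 = x ^+ 2]; otherwise [x * u + y * v] vanishes, which gives [u ^+ 2 = y ^+ 2]. *)
have sq : (x * v - y * u) ^+ 2 + (x * u + y * v) ^+ 2 = r%:Z ^+ 4.
  transitivity ((x ^+ 2 + y ^+ 2) * (u ^+ 2 + v ^+ 2)); first by ring.
  by rewrite xy uv; ring.
have {}AE : x * v - y * u = A' * r%:Z ^+ 2 by rewrite AE A'E; ring.
rewrite AE in sq prod.
have r4 : 0 < r%:Z ^+ 4 by rewrite exprn_gt0//; have := prime_gt0 pr; lia.
have A'1 : A' ^+ 2 <= 1.
  rewrite -(ler_pM2r r4) mul1r -[leRHS]sq.
  rewrite (_ : A' ^+ 2 * r%:Z ^+ 4 = (A' * r%:Z ^+ 2) ^+ 2); last by ring.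
  by rewrite lerDl sqr_ge0.
have [A'0|A'0] := eqVneq A' 0.
  left; move/eqP: prod; rewrite A'0 !mul0r eq_sym mulf_eq0 expf_eq0/= (negbTE r0).
  by rewrite subr_eq0 => /eqP.
right; have A'2 : A' ^+ 2 = 1.
  have : 0 < A' ^+ 2 by rewrite exprn_even_gt0.
  by move: A'1; clear; lia.
have : (x * u + y * v) ^+ 2 = 0.
  by apply: (addrI (r%:Z ^+ 4)); rewrite addr0 -[RHS]sq exprMn A'2 mul1r -exprM.
move=> /eqP; rewrite expf_eq0/= addr_eq0 => /eqP /(congr1 (fun z => z ^+ 2)).
rewrite sqrrN !exprMn vE => E.
have : r%:Z ^+ 2 * (u ^+ 2 - y ^+ 2) = 0.
  by rewrite mulrBr -{1}xy mulrDl E; ring.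
by move=> /eqP; rewrite mulf_eq0 expf_eq0/= (negbTE r0) subr_eq0 => /eqP.
Qed.

(** [r] divides the product of [x * v - y * u] and [x * v + y * u] but not their sum [2 * (x * v)],
    hence exactly one of them. Replacing [y] by [- y] exchanges the two cases. *)
Lemma sqr_sum_prime_unique r x y u v : prime r -> odd r ->
  x ^+ 2 + y ^+ 2 = r%:Z ^+ 2 -> u ^+ 2 + v ^+ 2 = r%:Z ^+ 2 ->
  x * y != 0 -> u * v != 0 -> u ^+ 2 = x ^+ 2 \/ u ^+ 2 = y ^+ 2.
Proof.
move=> pr oddr xy uv xy0 uv0.
have [[nx ny] [nu nv]] := (sqr_sum_ndvd xy xy0, sqr_sum_ndvd uv uv0).
have xNy : x ^+ 2 + (- y) ^+ 2 = r%:Z ^+ 2 by rewrite sqrrN.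
have r2 : ~~ (r %| 2%:Z)%Z.
  by rewrite dvdzE gtnNdvd//= ltn_neqAle prime_gt1// andbT; case: eqP oddr => // <-.
have n2xv : ~~ (r %| 2%:Z * (x * v))%Z.
  by do 2!(apply/negP => /(prime_dvdzM pr); apply/negP; rewrite negb_or ?r2 ?nx ?nv//=).
have : (r %| (x * v - y * u) * (x * v + y * u))%Z.
  apply/dvdzP; exists (r%:Z * (x ^+ 2 - u ^+ 2)).
  by rewrite (sqr_sum_prod xy uv); ring.
have sum2 : 2%:Z * (x * v) = (x * v - y * u) + (x * v + y * u) by ring.
move=> /(prime_dvdzM pr) /orP[dA|dB].
  apply: (sqr_sum_dvd pr xy uv dA); apply: contra n2xv => dB.
  by rewrite sum2 rpredD.
rewrite -[y ^+ 2]sqrrN; apply: (sqr_sum_dvd pr xNy uv); rewrite mulNr ?opprK//.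
by apply: contra n2xv => dA; rewrite sum2 rpredD.
Qed.

Lemma sqr_sum_prime_coprime r x y : prime r -> x ^+ 2 + y ^+ 2 = r%:Z ^+ 2 ->
  x * y != 0 -> coprimez x r.
Proof.
move=> pr xy xy0; have [nx _] := sqr_sum_ndvd xy xy0.
by rewrite coprimezE coprime_sym prime_coprime//; rewrite dvdzE in nx.
Qed.

Definition int_range r : seq int := [seq k%:Z - r%:Z | k <- iota 0 (r + r).+1].

Definition sqr_sum_seq r : seq (int * int) :=
  [seq q <- [seq (x, y) | x <- int_range r, y <- int_range r] |
    q.1 ^+ 2 + q.2 ^+ 2 == r%:Z ^+ 2].

Lemma sqr_sum_seq_uniq r : uniq (sqr_sum_seq r).
Proof.
have ur : uniq (int_range r).
  by rewrite map_inj_uniq ?iota_uniq// => k l; lia.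
by apply: filter_uniq; apply: allpairs_uniq => // -[? ?] [? ?].
Qed.

Lemma mem_sqr_sum_seq r x y :
  ((x, y) \in sqr_sum_seq r) = (x ^+ 2 + y ^+ 2 == r%:Z ^+ 2).
Proof.
rewrite mem_filter; apply: andb_idr => /eqP xy.
have range (z t : int) : z ^+ 2 + t ^+ 2 = r%:Z ^+ 2 -> z \in int_range r.
  move=> /sqr_sum_le zr; apply/mapP; exists (absz (z + r%:Z)); last by lia.
  by rewrite mem_iota; lia.
by apply: allpairs_f; [exact: range xy|rewrite addrC in xy; exact: range xy].
Qed.

Lemma int_sqr_eq x y : x ^+ 2 = y ^+ 2 -> x \in [:: y; - y].
Proof. by move=> /eqP; rewrite eqf_sqr !inE. Qed.

Definition trivial_sqr_sums r : seq (int * int) :=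
  [:: (r%:Z, 0); (- r%:Z, 0); (0, r%:Z); (0, - r%:Z)].

Lemma mem_trivial_sqr_sums r x y : x ^+ 2 + y ^+ 2 = r%:Z ^+ 2 -> x * y = 0 ->
  (x, y) \in trivial_sqr_sums r.
Proof.
move=> xy /eqP; rewrite mulf_eq0 => /orP[]/eqP z0; move: xy; rewrite z0 expr0n/=.
  rewrite add0r => /int_sqr_eq; rewrite !inE.
  by move=> /orP[] /eqP ->; rewrite !xpair_eqE !eqxx ?orbT.
rewrite addr0 => /int_sqr_eq; rewrite !inE.
by move=> /orP[] /eqP ->; rewrite !xpair_eqE !eqxx ?orbT.
Qed.

Lemma nontrivial_sqr_sum r : (4 < size (sqr_sum_seq r))%N ->
  exists x y, x ^+ 2 + y ^+ 2 = r%:Z ^+ 2 /\ x * y != 0.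
Proof.
move=> s4; have : ~~ all (fun u : int * int => u.1 * u.2 == 0) (sqr_sum_seq r).
  apply: contraL s4 => /allP alltriv; rewrite -leqNgt.
  apply: (uniq_leq_size (s2 := trivial_sqr_sums r) (sqr_sum_seq_uniq r)).
  move=> [x y] xy; apply: mem_trivial_sqr_sums; last exact/eqP/(alltriv (x, y)).
  by move: xy; rewrite mem_sqr_sum_seq => /eqP.
rewrite -has_predC => /hasP[[x y]]; rewrite mem_sqr_sum_seq => /eqP xy xy0.
by exists x, y.
Qed.

Lemma size_sqr_sum_seq r : prime r -> odd r -> (size (sqr_sum_seq r) <= 12)%N.
Proof.
move=> pr oddr; rewrite leqNgt; apply/negP => s12.
have s4 : (4 < size (sqr_sum_seq r))%N by exact: leq_trans s12.
have [u [v [uv uv0]]] := nontrivial_sqr_sum s4.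
pose nontriv := [:: (u, v); (u, - v); (- u, v); (- u, - v);
                    (v, u); (v, - u); (- v, u); (- v, - u)].
suff : (size (sqr_sum_seq r) <= size (trivial_sqr_sums r ++ nontriv))%N.
  by rewrite leqNgt s12.
apply: uniq_leq_size; first exact: sqr_sum_seq_uniq.
move=> [x y]; rewrite mem_sqr_sum_seq mem_cat => /eqP xy.
have [xy0|xy0] := eqVneq (x * y) 0; first by rewrite mem_trivial_sqr_sums.
apply/orP; right; have [xu|xv] := sqr_sum_prime_unique pr oddr uv xy uv0 xy0.
  have yv : y ^+ 2 = v ^+ 2 by apply: (addrI (u ^+ 2)); rewrite -{1}xu xy uv.
  move/int_sqr_eq: xu; move/int_sqr_eq: yv; rewrite !inE.
  by move=> /orP[]/eqP -> /orP[]/eqP ->; rewrite !xpair_eqE !eqxx ?orbT.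
have yu : y ^+ 2 = u ^+ 2 by apply: (addrI (v ^+ 2)); rewrite -{1}xv xy addrC uv.
move/int_sqr_eq: xv; move/int_sqr_eq: yu; rewrite !inE.
by move=> /orP[]/eqP -> /orP[]/eqP ->; rewrite !xpair_eqE !eqxx ?orbT.
Qed.

End NumberTheory.

(** * The torus of the theorem *)

Section TorusThree.
Context {R : realType} (r : nat).
Hypothesis r_prime : prime r.

Let q : R := Num.sqrt (2 / 3).
Let t : R := Num.sqrt 3.

Let t2 : t ^+ 2 = 3. Proof. by rewrite /t sqr_sqrtr. Qed.
Let q2 : q ^+ 2 = 2 / 3. Proof. by rewrite /q sqr_sqrtr// divr_ge0. Qed.
Let t0 : t != 0. Proof. by rewrite /t gt_eqF// sqrtr_gt0. Qed.
Let q0 : q != 0. Proof. by rewrite /q gt_eqF// sqrtr_gt0 divr_gt0. Qed.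
Let r0 : r%:R != 0 :> R. Proof. by rewrite pnatr_eq0 -lt0n prime_gt0. Qed.

Let q_sqrt2 : q * - (Num.sqrt 2)^-1 = - 1 / t.
Proof.
have <- : q * t = Num.sqrt 2 by rewrite /q /t -sqrtrM ?divr_ge0// divfK.
by field; rewrite q0 t0.
Qed.

Lemma dot_row3 (a b c a' b' c' : R) :
  dot (row3 a b c) (row3 a' b' c') = a * a' + b * b' + c * c'.
Proof. by rewrite /dot !big_ord_recl big_ord0 !mxE/= addr0 addrA. Qed.

(** Orthogonal coordinates: the lattice of the theorem is the part where [m + x + y] is even. *)
Definition freq (m x y : int) : 'rV[R]_3 :=
  row3 (m%:~R / t) (q / r%:R * x%:~R) (q / r%:R * y%:~R).

Lemma scale_row3 (a b c d : R) : d *: row3 a b c = row3 (d * a) (d * b) (d * c).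
Proof. by apply/rowP => i; rewrite !mxE; case: i => [[|[|[|//]]]]. Qed.

Lemma eta_freq (i : 'I_3) :
  eta r i = [:: freq 2 0 0; freq (-1) 1 0; freq (-1) 0 1]`_i.
Proof.
case: i => [[|[|[|//]]]] ? /=; rewrite /eta/= /freq ?scale_row3 ?q_sqrt2;
  by rewrite ?mulr0 ?mulr1 ?mulrN1z.
Qed.

Lemma freqD m x y m' x' y' :
  freq m x y + freq m' x' y' = freq (m + m') (x + x') (y + y').
Proof.
apply/rowP => i; rewrite !mxE; case: i => [[|[|[|//]]]] ? /=;
  by rewrite intrD; ring.
Qed.

Lemma freqMz m x y c : freq m x y *~ c = freq (m * c) (x * c) (y * c).
Proof.
rewrite -scaler_int; apply/rowP => i; rewrite !mxE.
by case: i => [[|[|[|//]]]] ? /=; rewrite intrM; ring.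
Qed.

Lemma freq_inj m x y m' x' y' : freq m x y = freq m' x' y' -> x = x' /\ y = y'.
Proof.
move=> /rowP E; have := E (lift ord0 ord0); have := E (lift ord0 (lift ord0 ord0)).
rewrite !mxE/= => /mulfI yy /mulfI xx.
by split; apply: (@intr_inj R); [apply: xx|apply: yy]; rewrite mulf_neq0 ?invr_eq0.
Qed.

Lemma Lambda3_dualP xi : @Lambda3_dual R r xi <->
  exists a x y, xi = freq (2 * a - x - y) x y.
Proof.
have E (c : 'I_3 -> int) : \sum_(i < 3) eta r i *~ c i =
    freq (2 * c ord0 - c (lift ord0 ord0) - c (lift ord0 (lift ord0 ord0)))
      (c (lift ord0 ord0)) (c (lift ord0 (lift ord0 ord0))) :> 'rV[R]_3.
  rewrite !big_ord_recl big_ord0 addr0 !eta_freq/= !freqMz !freqD.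
  by congr freq; ring.
split=> [[c ->]|[a [x [y ->]]]]; first by rewrite E; do 3!eexists.
by exists (fun i => [:: a; x; y]`_i); rewrite E.
Qed.

Lemma dot_freq m x y :
  dot (freq m x y) (freq m x y) =
  (m%:~R ^+ 2 + 2 * (x%:~R ^+ 2 + y%:~R ^+ 2) / r%:R ^+ 2) / 3.
Proof.
rewrite dot_row3 -!expr2 !exprMn !exprVn t2 q2.
by field.
Qed.

(** In [m ^+ 2 * r ^+ 2 + 2 * (x ^+ 2 + y ^+ 2) = 3 * r ^+ 2], a value [m ^+ 2 >= 4] is too large,
    and [m = 0] would make an even number odd. *)
Lemma unit_freq m x y : odd r -> dot (freq m x y) (freq m x y) = 1 ->
  m ^+ 2 = 1 /\ x ^+ 2 + y ^+ 2 = r%:Z ^+ 2.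
Proof.
move=> r_odd; rewrite dot_freq => E.
have {}E : m ^+ 2 * r%:Z ^+ 2 + 2 * (x ^+ 2 + y ^+ 2) = 3 * r%:Z ^+ 2.
  apply: (@intr_inj R); rewrite !(intrD, intrM, rmorphXn)/=.
  transitivity (3 * r%:R ^+ 2 * ((m%:~R ^+ 2 +
      2 * (x%:~R ^+ 2 + y%:~R ^+ 2) / r%:R ^+ 2) / 3) : R); first by field.
  by rewrite E mulr1.
have r2 := odd_sqr r_odd.
have rgt0 : 0 < r%:Z ^+ 2 by rewrite exprn_gt0// ltz_nat prime_gt0.
have [m2|[m0|m1]] : 4 <= m ^+ 2 \/ m = 0 \/ m ^+ 2 = 1.
  have [->|[->|[->|m2]]] : m = 0 \/ m = 1 \/ m = -1 \/ (2 <= m \/ m <= -2).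
  - by clear; lia.
  - by right; left.
  - by right; right.
  - by right; right.
  - by left; clear -m2; case: m2 => m2; nia.
- have : 4 * r%:Z ^+ 2 <= m ^+ 2 * r%:Z ^+ 2 by rewrite ler_pM2r.
  have : 0 <= x ^+ 2 + y ^+ 2 by rewrite addr_ge0 ?sqr_ge0.
  by lia.
- by rewrite m0 expr0n/= mul0r add0r r2 in E; lia.
- by rewrite m1 mul1r in E; split=> //; lia.
Qed.

Definition dual_eta (i : 'I_3) : 'rV[R]_3 :=
  [:: row3 (t / 2) (r%:R / (2 * q)) (r%:R / (2 * q));
      row3 0 (r%:R / q) 0; row3 0 0 (r%:R / q)]`_i.

Lemma dual_etaP i j : dot (eta r i) (dual_eta j) = (i == j)%:R.
Proof.
rewrite eta_freq; case: i => [[|[|[|//]]]] ?; case: j => [[|[|[|//]]]] ?;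
  rewrite /dual_eta /freq /= dot_row3 ?mulrN1z ?mulr0z ?mulr1z;
  by field; rewrite ?q0 ?t0 ?r0.
Qed.

Definition half_spectrum : seq 'rV[R]_3 :=
  [seq freq 1 u.1 u.2 | u <- sqr_sum_seq r].

Lemma half_spectrumP xi : reflect
  (exists x y, x ^+ 2 + y ^+ 2 = r%:Z ^+ 2 /\ xi = freq 1 x y)
  (xi \in half_spectrum).
Proof.
apply: (iffP mapP) => [[[x y]]|[x [y [xy ->]]]].
  by rewrite mem_sqr_sum_seq => /eqP xy ->; exists x, y.
by exists (x, y) => //; rewrite mem_sqr_sum_seq xy.
Qed.

Lemma half_spectrum_uniq : uniq half_spectrum.
Proof.
rewrite map_inj_uniq ?sqr_sum_seq_uniq// => -[x y] [x' y'] /= /freq_inj.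
by move=> [-> ->].
Qed.

Lemma half_spectrum_sub : odd r ->
  {in half_spectrum, forall xi, @Lambda3_dual R r xi}.
Proof.
move=> r_odd xi /half_spectrumP[x [y [xy ->]]]; apply/Lambda3_dualP.
have half z : exists b e : int, z = 2 * b + e /\ (e = 0 \/ e = 1).
  by exists (z %/ 2)%Z, (z %% 2)%Z; lia.
have r2 := odd_sqr r_odd.
have [b [e [xE e01]]] := half x; have [b' [e' [yE e'01]]] := half y.
(* The witness is [(x + y + 1) / 2]: exactly one of [x] and [y] is odd, as [r ^+ 2] is odd. *)
exists (b + b' + 1), x, y; congr freq.
rewrite r2 xE yE in xy; rewrite xE yE.
have sq (c d : int) : (2 * c + d) ^+ 2 = 4 * (c ^+ 2 + c * d) + d ^+ 2 by ring.
rewrite !sq in xy.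
by case: e01 xy => ->; case: e'01 => ->; rewrite ?mulr0 ?mulr1 ?expr1n ?expr0n/=; lia.
Qed.

Lemma half_spectrum_opp : {in half_spectrum &, forall xi zeta, xi + zeta != 0}.
Proof.
move=> _ _ /half_spectrumP[x [y [_ ->]]] /half_spectrumP[x' [y' [_ ->]]].
rewrite freqD; apply/eqP => /rowP/(_ ord0)/eqP; rewrite !mxE/=.
by rewrite mulf_eq0 invr_eq0 (negbTE t0) intr_eq0.
Qed.

Lemma half_spectrum_unit xi : odd r -> @Lambda3_dual R r xi -> dot xi xi = 1 ->
  (xi \in half_spectrum) || (- xi \in half_spectrum).
Proof.
move=> r_odd /Lambda3_dualP[a [x [y ->]]] /(unit_freq r_odd)[].
move/eqP; rewrite sqrf_eq1 => /orP[]/eqP -> xy.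
  by apply/orP; left; apply/half_spectrumP; exists x, y.
apply/orP; right; apply/half_spectrumP; exists (- x), (- y); rewrite !sqrrN.
by split=> //; rewrite -mulrN1z freqMz; congr freq; ring.
Qed.

Lemma half_spectrum_size : odd r -> (size half_spectrum <= 12)%N.
Proof. by move=> r_odd; rewrite size_map; exact: size_sqr_sum_seq. Qed.

(** The points [(r, 0)] and [(- r, 0)] make [2 * a] and [2 * r * b] integers, and [(u, v)] with
    [(- u, v)] does so for [2 * u * b]; as [u] is prime to [r], [2 * b] is an integer, and likewise
    [2 * c]. The values of [d] on the lattice are integer combinations of [2 * a], [a + b] and
    [a + c]. *)
Lemma half_spectrum_generates (d : 'rV[R]_3) : odd r -> (4 < size half_spectrum)%N ->
  {in half_spectrum, forall xi, dot xi d \is a Num.int} ->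
  dual_lattice (@Lambda3_dual R r) d.
Proof.
move=> r_odd; rewrite size_map => /nontrivial_sqr_sum[u [v [uv uv0]]] int_d.
pose a := dot (freq 1 0 0) d; pose b := dot (freq 0 1 0) d.
pose c := dot (freq 0 0 1) d.
have dotE m x y : dot (freq m x y) d = m%:~R * a + x%:~R * b + y%:~R * c.
  rewrite (_ : freq m x y = freq 1 0 0 *~ m + freq 0 1 0 *~ x + freq 0 0 1 *~ y).
    by rewrite !dotDl !dotMz.
  by rewrite !freqMz !freqD; congr freq; ring.
have I x y : x ^+ 2 + y ^+ 2 = r%:Z ^+ 2 ->
    a + x%:~R * b + y%:~R * c \is a Num.int.
  move=> xy; have := int_d (freq 1 x y); rewrite dotE mul1r; apply.
  by apply/half_spectrumP; exists x, y.
have /coprimezP[[k l] /= kl] := sqr_sum_prime_coprime r_prime uv uv0.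
have int2 (w : R) : u%:~R * (2 * w) \is a Num.int -> r%:R * (2 * w) \is a Num.int ->
    2 * w \is a Num.int.
  move=> uw rw; rewrite (_ : 2 * w =
      k%:~R * (u%:~R * (2 * w)) + l%:~R * (r%:R * (2 * w))).
    by rewrite rpredD// rpredM// intr_int.
  have /(congr1 (fun z : int => z%:~R : R)) := kl; rewrite intrD !intrM => klR.
  by rewrite (mulrA k%:~R) (mulrA l%:~R) -mulrDl -[r%:R]pmulrn klR mul1r.
have Nuv : (- u) ^+ 2 + v ^+ 2 = r%:Z ^+ 2 by rewrite sqrrN.
have vu : v ^+ 2 + u ^+ 2 = r%:Z ^+ 2 by rewrite addrC.
have vNu : v ^+ 2 + (- u) ^+ 2 = r%:Z ^+ 2 by rewrite sqrrN addrC.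
have rr0 : r%:Z ^+ 2 + 0 ^+ 2 = r%:Z ^+ 2 by rewrite expr0n addr0.
have Nr0 : (- r%:Z) ^+ 2 + 0 ^+ 2 = r%:Z ^+ 2 by rewrite sqrrN expr0n addr0.
have r0r : 0 ^+ 2 + r%:Z ^+ 2 = r%:Z ^+ 2 by rewrite expr0n add0r.
have r0N : 0 ^+ 2 + (- r%:Z) ^+ 2 = r%:Z ^+ 2 by rewrite sqrrN expr0n add0r.
have intD (X Y Z : R) : X \is a Num.int -> Y \is a Num.int -> Z = X + Y ->
    Z \is a Num.int by move=> hX hY ->; rewrite rpredD.
have intB (X Y Z : R) : X \is a Num.int -> Y \is a Num.int -> Z = X - Y ->
    Z \is a Num.int by move=> hX hY ->; rewrite rpredB.
have a2 : 2 * a \is a Num.int.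
  by apply: (intD _ _ _ (I _ _ rr0) (I _ _ Nr0)); rewrite rmorphN/=; ring.
have b2 : 2 * b \is a Num.int.
  apply: int2.
    by apply: (intB _ _ _ (I _ _ uv) (I _ _ Nuv)); rewrite rmorphN/=; ring.
  by apply: (intB _ _ _ (I _ _ rr0) (I _ _ Nr0)); rewrite rmorphN/=; ring.
have c2 : 2 * c \is a Num.int.
  apply: int2.
    by apply: (intB _ _ _ (I _ _ vu) (I _ _ vNu)); rewrite rmorphN/=; ring.
  by apply: (intB _ _ _ (I _ _ r0r) (I _ _ r0N)); rewrite rmorphN/=; ring.
have rE : r%:Z%:~R = 2 * r./2%:R + 1 :> R.
  rewrite [in LHS](_ : r = (r./2 * 2 + 1)%N); last by lia.
  by rewrite -pmulrn natrD natrM; ring.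
have halfM (X : R) : X \is a Num.int -> r./2%:R * X \is a Num.int.
  by move=> hX; rewrite rpredM// natr_int.
(* [a + r * b] is an integer and [r] is odd, so removing [r./2] times [2 * b] leaves [a + b]. *)
have ab : a + b \is a Num.int.
  by apply: (intB _ _ _ (I _ _ rr0) (halfM _ b2)); rewrite rE; ring.
have ac : a + c \is a Num.int.
  by apply: (intB _ _ _ (I _ _ r0r) (halfM _ c2)); rewrite rE; ring.
move=> xi /Lambda3_dualP[m [x [y ->]]]; rewrite dotC dotE.
rewrite (_ : _ + _ = m%:~R * (2 * a) - x%:~R * (2 * a) - y%:~R * (2 * a) +
  x%:~R * (a + b) + y%:~R * (a + c)).
  by rewrite !(rpredD, rpredB, rpredN)// rpredM// intr_int.
by rewrite !intrD !rmorphN/= intrM; ring.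
Qed.

End TorusThree.

Theorem proposition5p5 (R : realType) (r : nat) (r_prime : prime r)
    (r_mod4 : (r = 1 %[mod 4])%N) (f : torus3 R r -> 'rV[R]_24)
    (f_sphere : in_unit_sphere f) (f_immersion : immersion f)
    (f_isometric : isometric (4 * pi ^+ 2 / 3) f)
    (f_minimal : minimal f) (f_full : full f) :
  embedding f.
Proof.
have r_odd : odd r.
  by have := congr1 odd r_mod4; rewrite !odd_mod.
have bp := @dual_etaP R r r_prime.
have sF := f_immersion.1.
have tf : torus_map (dual_eta r) (periodic_lift f).
  by split => // i x; exact: (periodic_lift_periodic bp).
have c0 : 0 < 4 * pi ^+ 2 / 3 :> R by rewrite divr_gt0// mulr_gt0// exprn_gt0// pi_gt0.
have spec (k : 'I_24) xi a : lattice_span (eta r) xi ->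
    mean (codom (dual_eta r)) ((fun x => periodic_lift f x 0 k) \* wave xi a) != 0 ->
    (xi \in half_spectrum r) || (- xi \in half_spectrum r).
  move=> Lxi Mxi; apply: half_spectrum_unit => //.
  have := eigen_spectrum bp tf c0 (fun x => f_sphere _) f_isometric f_minimal Lxi Mxi.
  rewrite (_ : _ * (_ / 3) = (2 * pi) ^+ 2 * 1); last by field.
  by move/mulfI; apply; rewrite expf_neq0// mulf_neq0// gt_eqF// pi_gt0.
have us := @half_spectrum_uniq R r r_prime.
have sL := @half_spectrum_sub R r r_prime r_odd.
have sN := @half_spectrum_opp R r.
have s12 : size (@half_spectrum R r) = 12%N.
  apply/eqP; rewrite eqn_leq half_spectrum_size//=.
  by have := full_spectrum_size bp tf f_full us sL sN spec; lia.
split=> //; apply: (injective_homeo_onto_image bp).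
  by move=> x; exact/differentiable_continuous/smooth_differentiable.
move=> u v fuv; rewrite -[u]reprK -[v]reprK; apply/torus_pi_eq.
apply: half_spectrum_generates => //; first by rewrite s12.
apply: (full_spectrum_separates bp tf f_full us sL sN spec); first by rewrite s12.
by rewrite /periodic_lift !reprK.
Qed.
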